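(* There exist two solutions $(A,\phi)$ of the Kapustin-Witten equations $$F_A-\phi\wedge\phi-\star d_A\phi=0,\qquad d_A^{\star}\phi=0$$ on $S^3\times(0,+\infty)$ satisfying the Nahm pole boundary condition at $y=0$, one with instanton number $\frac12$ and one with instanton number $-\frac12$.
   Context: $S^3\subset\mathbb{H}$ is the unit quaternions with the round metric induced from $\mathbb{R}^4$, $y$ is the coordinate on $(0,+\infty)$, and $S^3\times(0,+\infty)$ has the product metric with Hodge star $\star$. It is oriented so that $\Psi(y,\omega)=e^y\omega$ is orientation preserving into $\mathbb{R}^4$ with its standard orientation. $\mathfrak{su}(2)$ is identified with the imaginary quaternions; $A$ (a connection form on the trivial $SU(2)$ bundle) and $\phi$ are $\mathfrak{su}(2)$-valued 1-forms. $F_A=dA+A\wedge A$, $d_A\phi=d\phi+A\wedge\phi+\phi\wedge A$, and $d_A^\star\phi=0$ means $d\star\phi+A\wedge\star\phi+\star\phi\wedge A=0$. Nahm pole boundary condition: there exist, at each point of $S^3$, an orthonormal basis $\{e_a\}_{a=1,2,3}$ of the tangent space of $S^3$ with dual basis $\{e_a^\star\}$, and elements $t_a$ of the adjoint bundle with $[t_a,t_b]=\epsilon_{abc}t_c$, such that the expansions in $y$ near $y=0$ are $\phi\sim\frac{\sum_{a=1}^3t_ae_a^\star}{y}+\phi_0+\dots$ and $A\sim A_0+ya_1+\dots$. The instanton number is $\frac{1}{4\pi^2}\int_{S^3\times(0,+\infty)}\mathrm{tr}(F_A\wedge F_A)$ with $\mathrm{tr}(F_A\wedge F_A)=(|F_A^+|^2-|F_A^-|^2)\,d\mathrm{vol}$,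 where $F_A^\pm$ are the self-dual/anti-self-dual parts and the norm is normalized by $|I|=|J|=|K|=1$ and $|e^i\wedge e^j|=1$ for orthonormal coframes. *)

(* Defs.v *)
From mathcomp Require Import all_boot all_order all_algebra.
From mathcomp Require Import all_classical all_reals all_analysis.
Set Implicit Arguments.
Unset Strict Implicit.
Unset Printing Implicit Defensive.
Import Order.TTheory GRing.Theory Num.Theory.
Import numFieldNormedType.Exports.
Local Open Scope classical_set_scope.
Local Open Scope ring_scope.

(* The entries of a row vector are its coordinates in the basis 1, I, J, K.
   The library norm on ['rV[R]_4] is the sup norm, so the Euclidean inner
   product and norm are defined separately. *)
Notation quat R := 'rV[R]_4.

Definition mkquat (R : realType) (a b c d : R) : quat R :=
  \row_(i < 4) [:: a; b; c; d]`_i.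

Definition qmul (R : realType) (p q : quat R) : quat R :=
  let a1 := p 0 0 in let b1 := p 0 1 in let c1 := p 0 2 in let d1 := p 0 3 in
  let a2 := q 0 0 in let b2 := q 0 1 in let c2 := q 0 2 in let d2 := q 0 3 in
  mkquat (a1 * a2 - b1 * b2 - c1 * c2 - d1 * d2)
         (a1 * b2 + b1 * a2 + c1 * d2 - d1 * c2)
         (a1 * c2 - b1 * d2 + c1 * a2 + d1 * b2)
         (a1 * d2 + b1 * c2 - c1 * b2 + d1 * a2).

Definition qcomm (R : realType) (p q : quat R) : quat R := qmul p q - qmul q p.

Definition dot (R : realType) (p q : quat R) : R := \sum_(i < 4) p 0 i * q 0 i.

Definition qabs (R : realType) (p : quat R) : R := Num.sqrt (dot p p).

(* The condition cutting out su(2) inside the quaternions. *)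
Definition imaginary (R : realType) (p : quat R) : Prop := p 0 0 = 0.

Notation ambient R := (quat R * R)%type.

Definition sphere3 (R : realType) : set (quat R) := [set x | dot x x = 1].

Definition cyl (R : realType) : set (ambient R) :=
  [set p | sphere3 p.1 /\ 0 < p.2].

Definition tangent (R : realType) (p v : ambient R) : Prop := dot p.1 v.1 = 0.

(* An open neighbourhood of [cyl], a retraction of it onto [cyl], and the
   orthogonal projection of the ambient space onto the tangent space at p. *)
Definition cyl_nbhd (R : realType) : set (ambient R) :=
  [set q | q.1 != 0 /\ 0 < q.2].

Definition retract (R : realType) (q : ambient R) : ambient R :=
  ((qabs q.1)^-1 *: q.1, q.2).

Definition tproj (R : realType) (p v : ambient R) : ambient R :=
  (v.1 - dot p.1 v.1 *: p.1, v.2).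

(* The orthonormal tangent frame (d/dy, xI, xJ, xK) at p = (x, y). *)
Definition frame (R : realType) (p : ambient R) (i : 'I_4) : ambient R :=
  if i == 0 then (0, 1) else (qmul p.1 (delta_mx 0 i), 0).

(* Volume form of the product metric. For Psi (x, y) = e^y x, the differential
   of Psi at p = (x, y) sends v to e^y (v.1 + v.2 x); hence [vol] is
   e^(-4 y) times the pull-back by Psi of the standard volume form of R^4, and
   Psi is orientation preserving. *)
Definition vol (R : realType) (p v0 v1 v2 v3 : ambient R) : R :=
  \det (\matrix_(i < 4, j < 4)
    let v := nth 0 [:: v0; v1; v2; v3] i in (v.1 + v.2 *: p.1) 0 j).

(* Only the values at p in [cyl] on vectors tangent at p are meaningful. *)
Definition form1 (R : realType) := ambient R -> ambient R -> quat R.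
Definition form2 (R : realType) :=
  ambient R -> ambient R -> ambient R -> quat R.
Definition form3 (R : realType) :=
  ambient R -> ambient R -> ambient R -> ambient R -> quat R.
Definition form4 (R : realType) :=
  ambient R -> ambient R -> ambient R -> ambient R -> ambient R -> quat R.

(* Extension of a form from [cyl] to [cyl_nbhd]: it restricts to the given form
   on [cyl]. *)
Definition ext1 (R : realType) (a : form1 R) : form1 R := fun q v =>
  let p := retract q in a p (tproj p v).
Definition ext3 (R : realType) (c : form3 R) : form3 R := fun q u v w =>
  let p := retract q in c p (tproj p u) (tproj p v) (tproj p w).

(* Exterior derivative: d in the vector space H x R (on constant vector fields)
   of an extension, evaluated on tangent vectors. As d commutes with the
   restriction to a submanifold, this does not depend on the extension. *)
Definition d1 (R : realType) (a : form1 R) : form2 R := fun p u v =>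
  'D_u (fun q => ext1 a q v) p - 'D_v (fun q => ext1 a q u) p.
Definition d3 (R : realType) (c : form3 R) : form4 R := fun p v0 v1 v2 v3 =>
    'D_v0 (fun q => ext3 c q v1 v2 v3) p - 'D_v1 (fun q => ext3 c q v0 v2 v3) p
  + 'D_v2 (fun q => ext3 c q v0 v1 v3) p - 'D_v3 (fun q => ext3 c q v0 v1 v2) p.

Definition wedge11 (R : realType) (a b : form1 R) : form2 R := fun p u v =>
  qmul (a p u) (b p v) - qmul (a p v) (b p u).
Definition wedge13 (R : realType) (a : form1 R) (c : form3 R) : form4 R :=
  fun p v0 v1 v2 v3 =>
    qmul (a p v0) (c p v1 v2 v3) - qmul (a p v1) (c p v0 v2 v3)
  + qmul (a p v2) (c p v0 v1 v3) - qmul (a p v3) (c p v0 v1 v2).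
Definition wedge31 (R : realType) (c : form3 R) (a : form1 R) : form4 R :=
  fun p v0 v1 v2 v3 =>
    qmul (c p v0 v1 v2) (a p v3) - qmul (c p v0 v1 v3) (a p v2)
  + qmul (c p v0 v2 v3) (a p v1) - qmul (c p v1 v2 v3) (a p v0).

(* Hodge star, normalized by  b /\ star b = |b|^2 vol  for scalar forms: it is
   the contraction of [vol] with b, computed in an orthonormal frame. *)
Definition hodge1 (R : realType) (a : form1 R) : form3 R := fun p u v w =>
  \sum_(i < 4) vol p (frame p i) u v w *: a p (frame p i).
Definition hodge2 (R : realType) (b : form2 R) : form2 R := fun p u v =>
  2^-1 *: \sum_(i < 4) \sum_(j < 4)
    vol p (frame p i) (frame p j) u v *: b p (frame p i) (frame p j).

(* |b|^2, with |I| = |J| = |K| = 1 and |e^i /\ e^j| = 1 for i < j. *)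
Definition normsq2 (R : realType) (b : form2 R) (p : ambient R) : R :=
  \sum_(i < 4) \sum_(j < 4 | (i < j)%N)
    dot (b p (frame p i) (frame p j)) (b p (frame p i) (frame p j)).

Fixpoint Cn (R : realType) (V W : normedModType R) (n : nat) (U : set V)
    (f : V -> W) : Prop :=
  match n with
  | 0 => forall x, U x -> {for x, continuous f}
  | m.+1 => (forall x, U x -> differentiable f x) /\
            forall v : V, Cn m U (fun x => 'D_v f x)
  end.

Definition Cinfty (R : realType) (V W : normedModType R) (U : set V)
    (f : V -> W) : Prop := forall n, Cn n U f.

Definition su2_form1 (R : realType) (a : form1 R) : Prop :=
  [/\ forall p, cyl p -> forall v, tangent p v -> imaginary (a p v),
      forall p, cyl p -> forall (k : R) u v, tangent p u -> tangent p v ->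
        a p (k *: u + v) = k *: a p u + a p v
    & forall v, Cinfty (@cyl_nbhd R) (fun q => ext1 a q v)].

Definition curvature (R : realType) (A : form1 R) : form2 R := fun p u v =>
  d1 A p u v + wedge11 A A p u v.

Definition dA (R : realType) (A phi : form1 R) : form2 R := fun p u v =>
  d1 phi p u v + wedge11 A phi p u v + wedge11 phi A p u v.

Definition dA_hodge (R : realType) (A phi : form1 R) : form4 R :=
  fun p v0 v1 v2 v3 =>
    d3 (hodge1 phi) p v0 v1 v2 v3
  + wedge13 A (hodge1 phi) p v0 v1 v2 v3
  + wedge31 (hodge1 phi) A p v0 v1 v2 v3.

Definition kapustin_witten (R : realType) (A phi : form1 R) : Prop :=
  (forall p, cyl p -> forall u v, tangent p u -> tangent p v ->
     curvature A p u v - wedge11 phi phi p u v - hodge2 (dA A phi) p u v = 0)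
  /\
  (forall p, cyl p -> forall v0 v1 v2 v3,
     tangent p v0 -> tangent p v1 -> tangent p v2 -> tangent p v3 ->
     dA_hodge A phi p v0 v1 v2 v3 = 0).

Definition orthonormal_tangent_basis (R : realType) (x : quat R)
    (e : 'I_3 -> quat R) : Prop :=
  (forall a, dot x (e a) = 0) /\ (forall a b, dot (e a) (e b) = (a == b)%:R).

(* [t_a, t_b] = epsilon_abc t_c; indices in 'I_3 are added modulo 3, and the
   remaining cases follow by antisymmetry of the commutator. *)
Definition su2_triple (R : realType) (t : 'I_3 -> quat R) : Prop :=
  (forall a, imaginary (t a)) /\
  (forall a : 'I_3, qcomm (t a) (t (a + 1)) = t (a + 2)).

(* The expansions are asymptotic as y -> 0+, uniformly on S^3, up to the last
   displayed term: phi - sum_a t_a e_a^* / y - phi0 = o(1) and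
   A - A0 - y a1 = o(y). As the e_a are orthonormal, e_a^* is [dot (e a)]. The
   coefficients phi0, A0, a1 do not depend on y; they are forms
   in (x, v) with v tangent to S^3 x (0,+oo). *)
Definition nahm_pole (R : realType) (A phi : form1 R) : Prop :=
  exists (e t : quat R -> 'I_3 -> quat R)
         (phi0 A0 a1 : quat R -> ambient R -> quat R),
  [/\ forall x, sphere3 x -> orthonormal_tangent_basis x (e x),
      forall x, sphere3 x -> su2_triple (t x),
      [/\ su2_form1 (fun p => phi0 p.1), su2_form1 (fun p => A0 p.1)
        & su2_form1 (fun p => a1 p.1)],
      forall eps : R, 0 < eps -> \forall y \near 0^'+,
        forall x v, sphere3 x -> tangent (x, y) v ->
        dot v.1 v.1 + v.2 ^+ 2 <= 1 ->
        qabs (phi (x, y) v - y^-1 *: \sum_(a < 3) dot (e x a) v.1 *: t x a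
              - phi0 x v) <= eps
    & forall eps : R, 0 < eps -> \forall y \near 0^'+,
        forall x v, sphere3 x -> tangent (x, y) v ->
        dot v.1 v.1 + v.2 ^+ 2 <= 1 ->
        qabs (A (x, y) v - A0 x v - y *: a1 x v) <= eps * y].

(* Parametrizes S^3 x (0,+oo), up to a null set, by hyperspherical angles
   and y; the integral of f against the Riemannian volume is that of
   f (param s) |vol (d param)| against Lebesgue measure on [param_dom]. *)
Definition param (R : realType) (c t s y : R) : ambient R :=
  (mkquat (cos c) (sin c * cos t) (sin c * sin t * cos s)
          (sin c * sin t * sin s), y).

Definition param_dom (R : realType) : set (R * R * R * R) :=
  `]0, pi[ `*` `]0, pi[ `*` `]0, (2 * pi)[ `*` `]0, +oo[.

Definition param_density (R : realType) (c t s y : R) : R :=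
  `| vol (param c t s y)
       (derive1 (fun c' => param c' t s y) c)
       (derive1 (fun t' => param c t' s y) t)
       (derive1 (fun s' => param c t s' y) s)
       (derive1 (fun y' => param c t s y') y) |.

Definition lebesgue4 (R : realType) :=
  (((@lebesgue_measure R \x @lebesgue_measure R) \x @lebesgue_measure R)
    \x @lebesgue_measure R)%E.

Definition sd (R : realType) (F : form2 R) : form2 R := fun p u v =>
  2^-1 *: (F p u v + hodge2 F p u v).
Definition asd (R : realType) (F : form2 R) : form2 R := fun p u v =>
  2^-1 *: (F p u v - hodge2 F p u v).

(* tr (F_A /\ F_A) = trF2 A dvol *)
Definition trF2 (R : realType) (A : form1 R) (p : ambient R) : R :=
  normsq2 (sd (curvature A)) p - normsq2 (asd (curvature A)) p.

Definition instanton_integrand (R : realType) (A : form1 R)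
    (z : R * R * R * R) : R :=
  let: (c, t, s, y) := z in trF2 A (param c t s y) * param_density c t s y.

Definition has_instanton_number (R : realType) (A : form1 R) (k : R) : Prop :=
  (@lebesgue4 R).-integrable (@param_dom R) (EFin \o instanton_integrand A) /\
  (4 * pi ^+ 2)^-1 *
    Rintegral (@lebesgue4 R) (@param_dom R) (instanton_integrand A) = k.

(* Main.v *)
Require Import Defs.
From HB Require Import structures.
From mathcomp Require Import all_boot all_order all_algebra.
From mathcomp Require Import all_classical all_reals all_analysis.
From mathcomp Require Import measurable_realfun.
From mathcomp Require Import ring lra.
Import Order.TTheory GRing.Theory Num.Theory.
Import numFieldNormedType.Exports.
Local Open Scope classical_set_scope.
Local Open Scope ring_scope.
Set Implicit Arguments.
Unset Strict Implicit.
Unset Printing Implicit Defensive.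

(** Write theta for the left-invariant Maurer-Cartan form of S^3, theta = x^-1 dx,
that is theta = I e^1 + J e^2 + K e^3 in the coframe dual to xI, xJ, xK.  Look
for solutions A = f(y) theta and phi = g(y) theta with f = 1/2 + h.  Because
d theta = - theta /\ theta, and because the Hodge star exchanges dy /\ theta
with (1/2) theta /\ theta, the first Kapustin-Witten equation becomes
    h' = 4 h g,     g' = 2 h^2 - 1/2 - 2 g^2
([kapustin_witten_radial]).  The second equation holds for every pair f, g:
star phi is a multiple of g dy /\ theta /\ theta, so both d star phi and
A /\ star phi + star phi /\ A vanish; in coordinates both facts are the Jacobi
identity of the cross product ([alt4_jacobi], [dA_hodge_radial]).

Eliminating g = h' / (4 h) and putting h = s^2 gives s'' = 4 s^5 - s.  On the
energy level through the equilibrium h = 1/2, g = 0 this integrates to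
    h = sinh^2 y / (3 + 2 sinh^2 y),
    g = 3 cosh y / (2 sinh y (3 + 2 sinh^2 y)),
and the system is invariant under h |-> - h.  So for each sign e = 1, -1 the
pair f = 1/2 + e h, g is a solution ([profile_f_ode], [is_derive_profile_g]).

As y -> 0 one has h = O(y^2) and g = 1/(2y) + O(y)
([profile_h_bound], [profile_g_bound]); this is the Nahm pole with e_a = xI,
xJ, xK and t_a = I/2, J/2, K/2, with A_0 = theta / 2, a_1 = 0 and phi_0 = 0.

For the instanton number, the curvature of f(y) theta is
f' dy /\ theta + (f^2 - f) theta /\ theta, hence
tr (F /\ F) = 12 f' (f^2 - f) dvol = (e (4 h^3 - 3 h))' dvol
([trF2_radial]).  Since h runs from 0 to 1/2 and S^3 has volume 2 pi^2, the
instanton number is (1 / (4 pi^2)) (2 pi^2) (- e) = - e / 2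
([has_instanton_number_radial]).

Exterior derivatives are computed as directional derivatives of explicit
homogeneous extensions: the extension of f(y) theta multiplies a bilinear
expression in the ambient coordinates by f(y) / |q|, and |q| is stationary in
tangent directions.  Smoothness holds because all coefficients lie in a class
of elementary functions that is stable under directional derivatives
([elementary_derive]). *)

(** * Quaternion coordinates and the left-invariant frame *)

Section Quaternions.
Variable R : realType.
Implicit Types (p q x u v w : quat R).

Lemma ord4E (P : 'I_4 -> Prop) : P 0 -> P 1 -> P 2 -> P 3 -> forall i, P i.
Proof.
move=> P0 P1 P2 P3 [[|[|[|[|//]]]] i_lt4].
- by rewrite (_ : Ordinal _ = 0) //; apply/val_inj.
- by rewrite (_ : Ordinal _ = 1) //; apply/val_inj.
- by rewrite (_ : Ordinal _ = 2) //; apply/val_inj.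
- by rewrite (_ : Ordinal _ = 3) //; apply/val_inj.
Qed.

Lemma sum4E (V : nmodType) (F : 'I_4 -> V) :
  \sum_(i < 4) F i = F 0 + F 1 + F 2 + F 3.
Proof.
rewrite !big_ord_recr big_ord0 /= add0r.
by congr (F _ + F _ + F _ + F _); apply/val_inj.
Qed.

Lemma mkquatE (a b c d : R) : ((mkquat a b c d 0 0 = a) *
  (mkquat a b c d 0 1 = b) * (mkquat a b c d 0 2 = c) *
  (mkquat a b c d 0 3 = d))%type.
Proof. by rewrite /mkquat !mxE. Qed.

Lemma quatP p q : p 0 0 = q 0 0 -> p 0 1 = q 0 1 -> p 0 2 = q 0 2 ->
  p 0 3 = q 0 3 -> p = q.
Proof. by move=> ? ? ? ?; apply/rowP; apply: ord4E. Qed.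

Lemma quatD p q (i : 'I_4) : (p + q) 0 i = p 0 i + q 0 i.
Proof. by rewrite mxE. Qed.
Lemma quatN p (i : 'I_4) : (- p) 0 i = - p 0 i.
Proof. by rewrite mxE. Qed.
Lemma quatZ (k : R) p (i : 'I_4) : (k *: p) 0 i = k * p 0 i.
Proof. by rewrite mxE. Qed.
Lemma quat0 (i : 'I_4) : (0 : quat R) 0 i = 0.
Proof. by rewrite mxE. Qed.
Lemma quat_delta (i j : 'I_4) : (delta_mx 0 j : quat R) 0 i = (i == j)%:R.
Proof. by rewrite mxE eqxx. Qed.
Definition quatE := (mkquatE, quatD, quatN, quatZ, quat0, quat_delta).

Lemma dotE p q : dot p q =
  p 0 0 * q 0 0 + p 0 1 * q 0 1 + p 0 2 * q 0 2 + p 0 3 * q 0 3.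
Proof. by rewrite /dot sum4E. Qed.

Definition qconj p : quat R := mkquat (p 0 0) (- p 0 1) (- p 0 2) (- p 0 3).
Definition qim p : quat R := mkquat 0 (p 0 1) (p 0 2) (p 0 3).

(** The Maurer-Cartan form x^-1 dx: for x on S^3 and v tangent at x the product
    of the conjugate of x with v is already imaginary. Taking the imaginary part
    makes the formula bilinear on all of the ambient space and blind to the normal
    direction. *)
Definition theta x v : quat R := qim (qmul (qconj x) v).

(** The tangent vector c_0 d/dy + x (c_1 I + c_2 J + c_3 K): the components of c
    are its coordinates in [frame]. *)
Definition tvec x c : ambient R := (qmul x (qim c), c 0 0).

Definition cross u v : quat R := mkquat 0
  (u 0 2 * v 0 3 - u 0 3 * v 0 2)
  (u 0 3 * v 0 1 - u 0 1 * v 0 3)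
  (u 0 1 * v 0 2 - u 0 2 * v 0 1).

(** In the coordinates of [tvec], the 2-form a dy /\ theta + (b / 2) theta /\ theta.
    With this normalization of b the Hodge star merely exchanges a and b. *)
Definition sym2 (a b : R) u v : quat R :=
  a *: (u 0 0 *: qim v - v 0 0 *: qim u) + b *: cross u v.

(** Expanding rows of a matrix whose entries come from a function on [nat] keeps
    the minors of the same shape, so that the expansion can be iterated. *)
Lemma det_natE n (F : nat -> nat -> R) :
  \det (\matrix_(i < n.+1, j < n.+1) F i j) =
  \sum_(j < n.+1) F 0 j *
    ((-1) ^+ j * \det (\matrix_(i < n, k < n) F i.+1 (bump j k))).
Proof.
rewrite (expand_det_row _ ord0); apply: eq_bigr => j _; rewrite mxE /cofactor.
by congr (_ * (_ * \det _)); apply/matrixP => i k; rewrite !mxE.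
Qed.

Lemma det4E (v0 v1 v2 v3 : quat R) :
  \det (\matrix_(i < 4, j < 4) (nth 0 [:: v0; v1; v2; v3] i) 0 j) =
  let m2 i j := v2 0 i * v3 0 j - v2 0 j * v3 0 i in
  let m3 i j k := v1 0 i * m2 j k - v1 0 j * m2 i k + v1 0 k * m2 i j in
  v0 0 0 * m3 1 2 3 - v0 0 1 * m3 0 2 3 + v0 0 2 * m3 0 1 3 - v0 0 3 * m3 0 1 2.
Proof.
(* Indexing the entries by natural numbers lets the indices compute. *)
have [f fE] : exists f : quat R -> nat -> R,
    forall v (i : 'I_4), v 0 i = f v (nat_of_ord i).
  by exists (fun v n => v 0 (inord n)) => v i; rewrite inord_val.
rewrite (_ : \matrix_(i, j) _ =
  \matrix_(i < 4, j < 4) f (nth 0 [:: v0; v1; v2; v3] i) j); last first.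
  by apply/matrixP => i j; rewrite !mxE -fE.
rewrite (det_natE _ (fun i j => f (nth 0 [:: v0; v1; v2; v3] i) j)).
under eq_bigr => j _.
  rewrite (det_natE _ (fun i k => f (nth 0 [:: v0; v1; v2; v3] i.+1) (bump j k))).
  under eq_bigr => k _.
    rewrite (det_natE _ (fun i l =>
      f (nth 0 [:: v0; v1; v2; v3] i.+2) (bump j (bump k l)))).
    under eq_bigr => l _ do rewrite det_mx11 mxE.
    over.
  over.
rewrite /= !fE !big_ord_recr !big_ord0 /= /bump /=.
rewrite !modn_small //= !(add0n, addn0, add1n) /=; ring.
Qed.

(** Left multiplication by a unit quaternion is a rotation of R^4, so [vol] in the
    left-invariant frame is the plain determinant of the coordinates. *)
Lemma vol_tvec x y (u0 u1 u2 u3 : quat R) : dot x x = 1 ->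
  vol (x, y) (tvec x u0) (tvec x u1) (tvec x u2) (tvec x u3) =
  \det (\matrix_(i < 4, j < 4) (nth 0 [:: u0; u1; u2; u3] i) 0 j).
Proof.
move=> x1.
rewrite /vol /=.
rewrite (_ : \matrix_(i, j) _ = \matrix_(i < 4, j < 4)
  (nth 0 [:: qmul x u0; qmul x u1; qmul x u2; qmul x u3] i) 0 j); last first.
  have E u : (qmul x (qim u)) + u 0 0 *: x = qmul x u.
    by apply: quatP; rewrite /qmul /qim !quatE; ring.
  apply/matrixP => i j; rewrite mxE [RHS]mxE.
  by elim/ord4E: i; rewrite /= ?modn_small //= E.
rewrite !det4E /= /qmul !quatE.
(* Left multiplication by x has determinant |x|^4. *)
have x2 : dot x x ^+ 2 = 1 by rewrite x1 expr1n.
rewrite -[RHS]mul1r -x2 dotE.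
ring.
Qed.

Lemma frame_tvec (p : ambient R) i : frame p i = tvec p.1 (delta_mx 0 i).
Proof.
rewrite /frame /tvec quat_delta; case: eqVneq => [->|i0].
  rewrite ?eqxx; congr pair; apply: quatP; rewrite /qmul /qim !quatE /=; ring.
congr (qmul _ _, _).
by apply: quatP; rewrite /qim !quatE // eq_sym (negbTE i0).
Qed.

(** The inverse of [tvec] on tangent vectors. *)
Definition coef (p v : ambient R) : quat R :=
  mkquat v.2 (theta p.1 v.1 0 1) (theta p.1 v.1 0 2) (theta p.1 v.1 0 3).

Lemma theta_tvec x c : dot x x = 1 -> theta x (tvec x c).1 = qim c.
Proof.
move=> x1; rewrite /tvec /=.
rewrite (_ : theta _ _ = dot x x *: qim c); first by rewrite x1 scale1r.
by rewrite dotE; apply: quatP; rewrite /theta /qmul /qim /qconj !quatE; ring.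
Qed.

(** This lets every identity between forms be checked in the left-invariant frame.
    Up to the factor |x|^2 = 1, a vector v is x times the conjugate of x times v,
    and tangency kills the real part of the last product. *)
Lemma tangent_tvec (p v : ambient R) :
  cyl p -> tangent p v -> v = tvec p.1 (coef p v).
Proof.
case: p v => [x y] [v k] [/= x1 _] /= xv; rewrite /tvec /coef /= !quatE.
congr pair; rewrite -[LHS]scale1r -x1.
have -> : dot x x *: v = qmul x (theta x v) + dot x v *: x.
  by rewrite !dotE; apply: quatP; rewrite /theta /qmul /qim /qconj !quatE; ring.
rewrite [dot x v]xv scale0r addr0; congr (qmul _ _).
by apply: quatP; rewrite /theta /qim !quatE.
Qed.

Lemma tvec_tangent x y c : tangent (x, y) (tvec x c).
Proof.
by rewrite /tangent /tvec /= dotE /qmul /qim !quatE; ring.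
Qed.

End Quaternions.

(** * The Hodge star on left-invariant 2-forms *)

Section Hodge.
Variable R : realType.
Implicit Types (p q x u v w : quat R).

(** The double sum in [hodge2] has alternating coefficients times alternating
    values, so each unordered pair of indices is counted twice. *)
Lemma sum_alternating (V : lmodType R) (F : 'I_4 -> 'I_4 -> V) :
  (forall i, F i i = 0) -> (forall i j, F j i = F i j) ->
  2^-1 *: (\sum_(i < 4) \sum_(j < 4) F i j) =
  F 0 1 + F 0 2 + F 0 3 + F 1 2 + F 1 3 + F 2 3.
Proof.
move=> F0 FC; rewrite !sum4E !F0 !add0r !addr0.
rewrite (FC 0 1) (FC 0 2) (FC 0 3) (FC 1 2) (FC 1 3) (FC 2 3).
set s := RHS; have -> : F 0 1 + F 0 2 + F 0 3 + (F 0 1 + F 1 2 + F 1 3) +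
  (F 0 2 + F 1 2 + F 2 3) + (F 0 3 + F 1 3 + F 2 3) = s *+ 2.
  rewrite [s *+ 2]mulr2n /s !addrA.
  by rewrite [LHS](ACl (1*2*3*5*6*9*4*7*10*8*11*12)%AC).
by rewrite -[s *+ 2]scaler_nat scalerA mulVf ?scale1r // pnatr_eq0.
Qed.

Definition det_frame u v (i j : 'I_4) : R :=
  \det (\matrix_(k < 4, l < 4)
    (nth 0 [:: delta_mx 0 i : quat R; delta_mx 0 j : quat R; u; v] k) 0 l).

Definition sym2_frame a b (i j : 'I_4) : quat R :=
  sym2 a b (delta_mx 0 i) (delta_mx 0 j).

Lemma det_frame_alt u v :
  (forall i, det_frame u v i i = 0) /\
  (forall i j, det_frame u v j i = - det_frame u v i j).
Proof. by rewrite /det_frame; split=> *; rewrite !det4E /=; ring. Qed.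

Lemma det_frameE u v :
  let D := det_frame u v in
  let m i j := u 0 i * v 0 j - u 0 j * v 0 i in
  ((D 0 1 = m 2 3) * (D 0 2 = - m 1 3) * (D 0 3 = m 1 2) *
  (D 1 2 = m 0 3) * (D 1 3 = - m 0 2) * (D 2 3 = m 0 1))%type.
Proof.
rewrite /= /det_frame !det4E /= !quat_delta /=.
by refine (_, _, _, _, _, _); ring.
Qed.

Lemma sym2E a b u v : sym2 a b u v = mkquat 0
  (a * (u 0 0 * v 0 1 - v 0 0 * u 0 1) + b * (u 0 2 * v 0 3 - u 0 3 * v 0 2))
  (a * (u 0 0 * v 0 2 - v 0 0 * u 0 2) + b * (u 0 3 * v 0 1 - u 0 1 * v 0 3))
  (a * (u 0 0 * v 0 3 - v 0 0 * u 0 3) + b * (u 0 1 * v 0 2 - u 0 2 * v 0 1)).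
Proof.
by apply: quatP; rewrite /sym2 /cross /qim !quatE; ring.
Qed.

Lemma sym2_alt a b :
  (forall u, sym2 a b u u = 0) /\ (forall u v, sym2 a b v u = - sym2 a b u v).
Proof. by split=> *; rewrite !sym2E; apply: quatP; rewrite !quatE; ring. Qed.

Lemma sym2_frameE a b :
  let B := sym2_frame a b in
  ((B 0 1 = mkquat 0 a 0 0) * (B 0 2 = mkquat 0 0 a 0) *
   (B 0 3 = mkquat 0 0 0 a) *
   (B 1 2 = mkquat 0 0 0 b) * (B 1 3 = mkquat 0 0 (- b) 0) *
   (B 2 3 = mkquat 0 b 0 0))%type.
Proof.
rewrite /= /sym2_frame !sym2E !quat_delta /=.
by refine (_, _, _, _, _, _); apply: quatP; rewrite !quatE; ring.
Qed.

(** For the orientation of [vol] the frame d/dy, xI, xJ, xK is positive, whence the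
    star of dy /\ e^1 is e^2 /\ e^3 and cyclically. *)
Lemma hodge2_sym2 (B : form2 R) x y a b : dot x x = 1 ->
  (forall u v, B (x, y) (tvec x u) (tvec x v) = sym2 a b u v) ->
  forall u v, hodge2 B (x, y) (tvec x u) (tvec x v) = sym2 b a u v.
Proof.
move=> x1 BE u v; rewrite /hodge2.
under eq_bigr => i _ do under eq_bigr => j _ do
  rewrite !frame_tvec vol_tvec // BE -/(det_frame u v i j) -/(sym2_frame a b i j).
rewrite (sum_alternating (F := fun i j => det_frame u v i j *: sym2_frame a b i j)).
- rewrite !det_frameE !sym2_frameE.
  by rewrite sym2E; apply: quatP; rewrite !quatE; ring.
- by move=> i; rewrite (det_frame_alt u v).1 scale0r.
- move=> i j; rewrite (det_frame_alt u v).2 {1}/sym2_frame.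
  by rewrite (sym2_alt a b).2 scalerN scaleNr opprK.
Qed.

Lemma normsq2_sym2 (B : form2 R) x y a b :
  (forall u v, B (x, y) (tvec x u) (tvec x v) = sym2 a b u v) ->
  normsq2 B (x, y) = 3 * a ^+ 2 + 3 * b ^+ 2.
Proof.
move=> BE; rewrite /normsq2 sum4E.
rewrite !(big_mkcond (fun j : 'I_4 => (_ < j)%N)) /= !sum4E /=.
rewrite !frame_tvec !BE -!/(sym2_frame _ _ _ _) !sym2_frameE.
by rewrite !dotE !quatE; ring.
Qed.

End Hodge.

(** * Directional derivatives *)

Section Derivatives.
Variable R : realType.
Implicit Types (V W : normedModType R).

(** A directional derivative only sees the restriction to a line, which reduces
    chain rules to functions of one real variable. *)
Lemma is_derive_line V W (F : V -> W) (p u : V) dF :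
  is_derive p u F dF <-> is_derive (0 : R) 1 (fun h : R => F (h *: u + p)) dF.
Proof.
have E : (fun h : R => h^-1 *: ((F \o shift p) (h *: u) - F p)) =
  (fun h : R => h^-1 *: (((fun h : R => F (h *: u + p)) \o shift 0)
    (h *: (1 : R)) - F (0 *: u + p))).
  by apply/funext => h /=; rewrite scale0r add0r addr0 [h *: 1]mulr1.
by split=> -[dv <-]; split; rewrite /derivable /derive E in dv *.
Qed.

(** The difference quotient of a linear map is constant. *)
Lemma is_derive_linear V W (F : V -> W) (p u : V) :
  (forall k v w, F (k *: v + w) = k *: F v + F w) -> is_derive p u F (F u).
Proof.
move=> lin.
have cvgF : h^-1 *: ((F \o shift p) (h *: u) - F p) @[h --> 0^'] --> F u.
  apply: cvg_near_cst; near=> h => /=.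
  by rewrite lin addrK scalerA mulVf ?scale1r //; near: h; exact: nbhs_dnbhs_neq.
by split; [apply/cvg_ex; exists (F u) | apply/cvg_lim].
Unshelve. all: by end_near. Qed.

Lemma is_derive_rV V n (F : V -> 'rV[R]_n) (p u : V) (dF : 'rV[R]_n) :
  (forall i, is_derive p u (fun q => F q 0 i) (dF 0 i)) -> is_derive p u F dF.
Proof.
move=> dFi.
have dF' : derivable F p u.
  by apply/derivable_mxP => i j; rewrite ord1; apply: ex_derive.
split=> //; rewrite derive_mx //; apply/rowP => i; rewrite mxE.
exact: derive_val.
Qed.

Lemma is_derive_comp V (s : V -> R) (g : R -> R) (p u : V) (ds dg : R) :
  is_derive p u s ds -> is_derive (s p) 1 g dg ->
  is_derive p u (fun q => g (s q)) (ds * dg).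
Proof.
move=> /is_derive_line sp gp; apply/is_derive_line; rewrite mulrC.
apply: (@is_derive1_comp _ g (fun h => s (h *: u + p))).
by rewrite scale0r add0r.
Qed.

Lemma is_derive_coord V n (F : V -> 'rV[R]_n) (p u : V) dF i :
  is_derive p u F dF -> is_derive p u (fun q => F q 0 i) (dF 0 i).
Proof.
case=> Fd <-; split; last by rewrite derive_mx ?mxE.
by move/derivable_mxP : Fd => /(_ 0 i).
Qed.

Lemma is_derive_scale V n (s : V -> R) (F : V -> 'rV[R]_n) (p u : V) ds dF :
  is_derive p u s ds -> is_derive p u F dF ->
  is_derive p u (fun q => s q *: F q) (ds *: F p + s p *: dF).
Proof.
move=> sp Fp; apply: is_derive_rV => i; have Fi := is_derive_coord i Fp.
rewrite (_ : (fun q => _) = s * (fun q => F q 0 i)); last first.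
  by apply/funext => q; rewrite mxE.
apply: is_derive_eq; rewrite !mxE /= addrC; congr (_ + _).
by rewrite mulrC.
Qed.

Lemma is_derive_cross V (F G : V -> quat R) (p u : V) dF dG :
  is_derive p u F dF -> is_derive p u G dG ->
  is_derive p u (fun q => cross (F q) (G q)) (cross dF (G p) + cross (F p) dG).
Proof.
move=> Fp Gp; apply: is_derive_rV.
have E i j : is_derive p u (fun q => F q 0 i * G q 0 j - F q 0 j * G q 0 i)
   (dF 0 i * G p 0 j - dF 0 j * G p 0 i + (F p 0 i * dG 0 j - F p 0 j * dG 0 i)).
  have Fi := is_derive_coord i Fp; have Fj := is_derive_coord j Fp.
  have Gi := is_derive_coord i Gp; have Gj := is_derive_coord j Gp.
  rewrite (_ : (fun q => _) = (fun q => F q 0 i) * (fun q => G q 0 j) -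
    (fun q => F q 0 j) * (fun q => G q 0 i)) //.
  apply: is_derive_eq; rewrite /GRing.scale /=; ring.
apply: ord4E; rewrite /cross !quatE.
- by under eq_fun do rewrite !quatE; rewrite addr0; exact: is_derive_cst.
- by under eq_fun do rewrite !quatE; exact: E.
- by under eq_fun do rewrite !quatE; exact: E.
- by under eq_fun do rewrite !quatE; exact: E.
Qed.

End Derivatives.

(** * The forms f(y) theta and their Hodge duals *)

Section Forms.
Variable R : realType.
Implicit Types (q x u v w : quat R).

Definition radial (f : R -> R) : form1 R :=
  fun p v : ambient R => f p.2 *: theta p.1 v.1.

Lemma thetaE x v : theta x v = mkquat 0
  (x 0 0 * v 0 1 - x 0 1 * v 0 0 - x 0 2 * v 0 3 + x 0 3 * v 0 2)
  (x 0 0 * v 0 2 + x 0 1 * v 0 3 - x 0 2 * v 0 0 - x 0 3 * v 0 1)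
  (x 0 0 * v 0 3 - x 0 1 * v 0 2 + x 0 2 * v 0 1 - x 0 3 * v 0 0).
Proof. by apply: quatP; rewrite /theta /qmul /qim /qconj !quatE; ring. Qed.

Lemma theta_linl v (k : R) x q :
  theta (k *: x + q) v = k *: theta x v + theta q v.
Proof. by rewrite !thetaE; apply: quatP; rewrite !quatE; ring. Qed.

Lemma theta_linr x (k : R) u v :
  theta x (k *: u + v) = k *: theta x u + theta x v.
Proof. by rewrite !thetaE; apply: quatP; rewrite !quatE; ring. Qed.

Lemma theta_diag x : theta x x = 0.
Proof. by rewrite thetaE; apply: quatP; rewrite !quatE; ring. Qed.

Lemma theta0l v : theta 0 v = 0.
Proof. by rewrite thetaE; apply: quatP; rewrite !quatE; ring. Qed.

(** With [theta_proj] this gives the extension of [theta] off the sphere: retracting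
    to the sphere divides by the norm and projecting changes nothing. *)
Lemma thetaZl (k : R) x v : theta (k *: x) v = k *: theta x v.
Proof. by have := theta_linl v k x 0; rewrite addr0 theta0l addr0. Qed.

Lemma theta_proj x v : theta x (v - dot x v *: x) = theta x v.
Proof. by rewrite addrC -scaleNr theta_linr theta_diag scaler0 add0r. Qed.

(** The Maurer-Cartan equation in disguise: antisymmetrized in u and v, the
    derivative of x |-> theta x v is - 2 [cross] = - theta /\ theta. *)
Lemma theta_tvec2 x u v : dot x x = 1 ->
  theta (tvec x u).1 (tvec x v).1 = - cross u v.
Proof.
move=> x1; rewrite -[RHS]scale1r -x1 dotE thetaE /tvec /= /qmul /qim.
by apply: quatP; rewrite /cross !quatE; ring.
Qed.

Lemma dot_gt0 (q : quat R) : q != 0 -> 0 < dot q q.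
Proof.
move=> q0; have [i qi] : exists i, q 0 i != 0.
  apply/existsP; apply: contra_neqT q0 => /existsPn q0; apply/rowP => i.
  by rewrite mxE; apply/eqP; rewrite -[_ == _]negbK.
rewrite /dot (bigD1 i) //= ltr_pwDl -?expr2 ?exprn_even_gt0 //.
by apply: sumr_ge0 => j _; rewrite -expr2 sqr_ge0.
Qed.

Lemma dot_normalized q : q != 0 -> dot ((qabs q)^-1 *: q) ((qabs q)^-1 *: q) = 1.
Proof.
move=> /dot_gt0 dot0.
have -> : dot ((qabs q)^-1 *: q) ((qabs q)^-1 *: q) = (qabs q) ^- 2 * dot q q.
  by rewrite !dotE !quatE -exprVn; ring.
by rewrite /qabs sqr_sqrtr ?(ltW dot0) // mulVf // gt_eqF.
Qed.

Lemma ext1_radial f (q v : ambient R) :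
  ext1 (radial f) q v = (f q.2 * (qabs q.1)^-1) *: theta q.1 v.1.
Proof. by rewrite /ext1 /radial /= theta_proj thetaZl scalerA. Qed.

(** The Hodge dual of theta, as a quadratic expression in x:
    up to sign dy /\ (1/2) theta /\ theta. *)
Definition hodge_theta x (u v w : ambient R) : quat R :=
  - (u.2 *: cross (theta x v.1) (theta x w.1)
   + v.2 *: cross (theta x w.1) (theta x u.1)
   + w.2 *: cross (theta x u.1) (theta x v.1)).

Lemma hodge1_radial g x y (u v w : quat R) : dot x x = 1 ->
  hodge1 (radial g) (x, y) (tvec x u) (tvec x v) (tvec x w) =
  g y *: hodge_theta x (tvec x u) (tvec x v) (tvec x w).
Proof.
move=> x1; rewrite /hodge1 /radial /hodge_theta !theta_tvec //=.
under eq_bigr => i _ do rewrite !frame_tvec vol_tvec // det4E theta_tvec //.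
rewrite sum4E /= !quat_delta /=.
by rewrite /cross /qim; apply: quatP; rewrite !quatE /=; ring.
Qed.

Lemma hodge_theta0l (u v w : ambient R) : hodge_theta 0 u v w = 0.
Proof.
rewrite /hodge_theta !theta0l; apply: quatP; rewrite /cross !quatE; ring.
Qed.

Lemma crossZ (a b : R) u v : cross (a *: u) (b *: v) = (a * b) *: cross u v.
Proof. by apply: quatP; rewrite /cross !quatE; ring. Qed.

(** [hodge_theta] is homogeneous of degree 2 in x, which explains the exponent of
    the norm. The case q.1 = 0, where the retraction is degenerate, is consistent
    because both sides vanish. *)
Lemma ext3_radial g (q u v w : ambient R) : 0 < q.2 ->
  ext3 (hodge1 (radial g)) q u v w =
  (g q.2 * (qabs q.1) ^- 2) *: hodge_theta q.1 u v w.
Proof.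
case: q => q y /= y0; rewrite /ext3 /retract /=.
have [->|q0] := eqVneq q 0.
  rewrite hodge_theta0l !scaler0 /hodge1 big1 // => i _.
  by rewrite /radial theta0l !scaler0.
set x := (qabs q)^-1 *: q.
have x1 : dot x x = 1 by exact: dot_normalized.
have tan z : tproj (x, y) z = tvec x (coef (x, y) z).
  have -> : coef (x, y) z = coef (x, y) (tproj (x, y) z).
    by rewrite /coef /= theta_proj.
  apply: (@tangent_tvec _ (x, y)); first by split.
  rewrite /tangent /=.
  have -> : dot x (z.1 - dot x z.1 *: x) = dot x z.1 - dot x z.1 * dot x x.
    by rewrite !dotE !quatE; ring.
  by rewrite x1 mulr1 subrr.
rewrite !tan hodge1_radial // -scalerA; congr (_ *: _).
rewrite /hodge_theta -!tan /= !theta_proj /x !thetaZl !crossZ.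
rewrite -exprVn expr2 scalerN; congr (- _).
by rewrite !scalerDr !scalerA ![_ * (_ * _)]mulrC.
Qed.

End Forms.

(** * Reduction of the Kapustin-Witten equations to an ODE system *)

Section Equations.
Variable R : realType.
Implicit Types (x : quat R).

(** Tangent directions are orthogonal to the radius, so functions of the norm are
    stationary along them. *)
Lemma is_derive_norm_tangent (g : R -> R) (p u : ambient R) :
  cyl p -> tangent p u -> derivable g 1 1 ->
  is_derive p u (fun q : ambient R => g (Num.sqrt (dot q.1 q.1))) 0.
Proof.
move=> [p1 _] pu dg.
have dot_der : is_derive p u (fun q : ambient R => dot q.1 q.1) 0.
  have c i : is_derive p u (fun q : ambient R => q.1 0 i) (u.1 0 i).
    by apply: is_derive_linear => k v w; rewrite !mxE.
  rewrite (_ : (fun q : ambient R => dot q.1 q.1) =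
     \sum_(i < 4) ((fun q : ambient R => q.1 0 i) * (fun q => q.1 0 i))); last first.
    by apply/funext => q; rewrite fct_sumE.
  apply: is_derive_eq.
  rewrite (_ : \sum_(i < 4) _ = 2 * dot p.1 u.1); first by rewrite [dot _ _]pu mulr0.
  by rewrite dotE sum4E /GRing.scale /=; ring.
have dsqrt : is_derive (1 : R) 1 (fun t => g (Num.sqrt t))
    ((2 * Num.sqrt 1)^-1 * 'D_1 g 1).
  apply: is_derive_comp; first exact: is_derive1_sqrt.
  by rewrite sqrtr1; apply: derivableP.
rewrite -[X in is_derive _ _ _ X](mul0r ((2 * Num.sqrt 1)^-1 * 'D_1 g 1)).
apply: (is_derive_comp (g := fun t => g (Num.sqrt t)) dot_der).
by rewrite [dot _ _]p1.
Qed.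

Lemma is_derive_snd (f : R -> R) (p u : ambient R) df :
  is_derive p.2 1 f df -> is_derive p u (fun q : ambient R => f q.2) (u.2 * df).
Proof.
move=> fp; have d2 : is_derive p u (snd : ambient R -> R) u.2.
  exact: is_derive_linear.
exact: is_derive_comp d2 fp.
Qed.

Lemma is_derive_theta (p u : ambient R) v :
  is_derive p u (fun q : ambient R => theta q.1 v) (theta u.1 v).
Proof.
apply: (@is_derive_linear _ _ _ (fun q : ambient R => theta q.1 v)) => k a b.
by rewrite theta_linl.
Qed.

Lemma derivable_inv1 : derivable (fun t : R => t^-1) 1 1.
Proof. by apply: derivableV => //; exact: oner_neq0. Qed.

Lemma derive_ext1_radial f df (p u v : ambient R) :
  cyl p -> tangent p u -> is_derive p.2 1 f df ->
  'D_u (fun q => ext1 (radial f) q v) p =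
  (u.2 * df) *: theta p.1 v.1 + f p.2 *: theta u.1 v.1.
Proof.
move=> cp tu fp; under eq_fun do rewrite ext1_radial.
apply: derive_val.
have n1 : (qabs p.1)^-1 = 1 by rewrite /qabs cp.1 sqrtr1 invr1.
have s : is_derive p u (fun q : ambient R => f q.2 * (qabs q.1)^-1) (u.2 * df).
  have a := is_derive_snd u fp.
  have b := is_derive_norm_tangent cp tu derivable_inv1.
  rewrite (_ : (fun q => _) = (fun q : ambient R => f q.2) *
      (fun q : ambient R => (Num.sqrt (dot q.1 q.1))^-1)) //.
  apply: is_derive_eq; rewrite /GRing.scale /= -/(qabs p.1) n1; ring.
have := is_derive_scale s (is_derive_theta p u v.1).
by rewrite /= n1 mulr1.
Qed.

Lemma d1_radial f df x y (u v : quat R) : cyl (x, y) -> is_derive y 1 f df ->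
  d1 (radial f) (x, y) (tvec x u) (tvec x v) = sym2 df (- (2 * f y)) u v.
Proof.
move=> cp fy; have x1 : dot x x = 1 by case: cp.
rewrite /d1 !(derive_ext1_radial _ cp (tvec_tangent _ _ _) fy) /=.
rewrite !(theta_tvec2 _ _ x1) !theta_tvec //.
by apply: quatP; rewrite /sym2 /cross /qim !quatE; ring.
Qed.

Lemma wedge11_radial f g x y (u v : quat R) : dot x x = 1 ->
  wedge11 (radial f) (radial g) (x, y) (tvec x u) (tvec x v) =
  sym2 0 (2 * (f y * g y)) u v.
Proof.
move=> x1; rewrite /wedge11 /radial !theta_tvec //.
by apply: quatP; rewrite /sym2 /cross /qim /qmul !quatE; ring.
Qed.

(** The antisymmetrization that occurs both in the exterior derivative of a 3-form
    and in the wedge product of a 1-form with a 3-form. *)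
Definition alt4 (V : zmodType) (F : quat R -> quat R -> quat R -> quat R -> V)
    (a b c d : quat R) : V :=
  F a b c d - F b a c d + F c a b d - F d a b c.

(** [hodge_theta] in the coordinates of [tvec]. *)
Definition hodge_theta_coef (a b c : quat R) : quat R :=
  - (a 0 0 *: cross b c + b 0 0 *: cross c a + c 0 0 *: cross a b).

(** Collecting the terms with a given dy-component leaves one cyclic sum of T. *)
Lemma alt4_jacobi (T : quat R -> quat R -> quat R -> quat R) :
  (forall a b c, T a c b = - T a b c) ->
  (forall a b c, T a b c + T b c a + T c a b = 0) ->
  forall a b c d, alt4 (fun a b c d =>
    b 0 0 *: T a c d + c 0 0 *: T a d b + d 0 0 *: T a b c) a b c d = 0.
Proof.
move=> TC TJ a b c d.
transitivity (- a 0 0 *: (T b c d + T c d b + T d b c)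
  + b 0 0 *: (T a c d + T c d a + T d a c)
  - c 0 0 *: (T a b d + T b d a + T d a b)
  + d 0 0 *: (T a b c + T b c a + T c a b)); last first.
  by rewrite !TJ !scaler0 !addr0 subr0.
rewrite /alt4 (TC c d b) (TC d a c) (TC a b d) (TC b c a).
by apply: quatP; rewrite !quatE; ring.
Qed.

Lemma crossC (a b : quat R) : cross b a = - cross a b.
Proof. by apply: quatP; rewrite /cross !quatE; ring. Qed.

Lemma cross_jacobi (a b c : quat R) :
  cross a (cross b c) + cross b (cross c a) + cross c (cross a b) = 0.
Proof. by apply: quatP; rewrite /cross !quatE; ring. Qed.

Lemma crossDr (a b c : quat R) : cross a (b + c) = cross a b + cross a c.
Proof. by apply: quatP; rewrite /cross !quatE; ring. Qed.

Lemma crossNr (a b : quat R) : cross a (- b) = - cross a b.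
Proof. by apply: quatP; rewrite /cross !quatE; ring. Qed.

Lemma crossNl (a b : quat R) : cross (- a) b = - cross a b.
Proof. by apply: quatP; rewrite /cross !quatE; ring. Qed.

Lemma crossZr (k : R) (a b : quat R) : cross a (k *: b) = k *: cross a b.
Proof. by apply: quatP; rewrite /cross !quatE; ring. Qed.

Lemma cross_qiml (a b : quat R) : cross (qim a) b = cross a b.
Proof. by apply: quatP; rewrite /cross /qim !quatE; ring. Qed.

Lemma cross_qimr (a b : quat R) : cross a (qim b) = cross a b.
Proof. by apply: quatP; rewrite /cross /qim !quatE; ring. Qed.

Lemma cross_hodge_theta_coef (a b c d : quat R) : cross a (hodge_theta_coef b c d) =
  - (b 0 0 *: cross a (cross c d) + c 0 0 *: cross a (cross d b)
    + d 0 0 *: cross a (cross b c)).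
Proof. by rewrite /hodge_theta_coef crossNr !crossDr !crossZr. Qed.

Lemma alt4_cross_hodge_theta (a b c d : quat R) :
  alt4 (fun a b c d => cross a (hodge_theta_coef b c d)) a b c d = 0.
Proof.
rewrite /alt4 !cross_hodge_theta_coef.
have := alt4_jacobi (T := fun a b c => cross a (cross b c)) _ cross_jacobi a b c d.
rewrite /alt4 => J; rewrite -[RHS]oppr0 -J; last first.
  by move=> u v w; rewrite (crossC v w) crossNr.
by rewrite !opprD !opprK.
Qed.

(** This is dy /\ dy = 0. *)
Lemma alt4_dy_hodge_theta (a b c d : quat R) :
  alt4 (fun a b c d => a 0 0 *: hodge_theta_coef b c d) a b c d = 0.
Proof.
by rewrite /alt4 /hodge_theta_coef; apply: quatP; rewrite /cross !quatE; ring.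
Qed.

Lemma hodge_theta_tvec x (a b c : quat R) : dot x x = 1 ->
  hodge_theta x (tvec x a) (tvec x b) (tvec x c) = hodge_theta_coef a b c.
Proof. by move=> x1; rewrite /hodge_theta !theta_tvec // !cross_qiml !cross_qimr. Qed.

(** The Jacobi identity again: taking the cross product with a is a derivation. *)
Lemma cross_derivation (a b c : quat R) :
  cross (cross a b) c + cross b (cross a c) = cross a (cross b c).
Proof. by apply: quatP; rewrite /cross !quatE; ring. Qed.

(** The directional derivative of [hodge_theta] along dx, by the Leibniz rule. *)
Definition hodge_theta_der (x du : quat R) (a b c : ambient R) : quat R :=
  - (a.2 *: (cross (theta du b.1) (theta x c.1)
             + cross (theta x b.1) (theta du c.1))
   + b.2 *: (cross (theta du c.1) (theta x a.1)
             + cross (theta x c.1) (theta du a.1))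
   + c.2 *: (cross (theta du a.1) (theta x b.1)
             + cross (theta x a.1) (theta du b.1))).

Lemma derive_ext3_radial g dg (p u : ambient R) (a b c : ambient R) :
  cyl p -> tangent p u -> is_derive p.2 1 g dg ->
  'D_u (fun q => ext3 (hodge1 (radial g)) q a b c) p =
  (u.2 * dg) *: hodge_theta p.1 a b c + g p.2 *:
  hodge_theta_der p.1 u.1 a b c.
Proof.
move=> cp tu gp.
have n1 : (qabs p.1) ^- 2 = 1 by rewrite /qabs cp.1 sqrtr1 expr1n invr1.
have s : is_derive p u (fun q : ambient R => g q.2 * (qabs q.1) ^- 2) (u.2 * dg).
  have da := is_derive_snd u gp.
  have dinv : derivable (fun t : R => (t ^+ 2)^-1) 1 1.
    apply: derivableV; last exact: exprn_derivable.
    by rewrite expr1n oner_neq0.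
  have db := is_derive_norm_tangent cp tu dinv.
  rewrite (_ : (fun q => _) = (fun q : ambient R => g q.2) *
      (fun q : ambient R => (Num.sqrt (dot q.1 q.1) ^+ 2)^-1)) //.
  apply: is_derive_eq; rewrite /GRing.scale /= -/(qabs p.1) n1; ring.
have o : is_derive p u (fun q : ambient R => hodge_theta q.1 a b c)
  (hodge_theta_der p.1 u.1 a b c).
  have da := is_derive_theta p u a.1; have db := is_derive_theta p u b.1.
  have dc := is_derive_theta p u c.1.
  have dbc := is_derive_cross db dc; have dca := is_derive_cross dc da.
  have dab := is_derive_cross da db.
  exact: is_deriveN (is_deriveD (is_deriveD (is_deriveZ a.2 dbc)
    (is_deriveZ b.2 dca)) (is_deriveZ c.2 dab)).
rewrite (@near_eq_derive _ _ _ _ (fun q : ambient R =>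
  (g q.2 * (qabs q.1) ^- 2) *: hodge_theta q.1 a b c)).
  by have -> := @derive_val _ _ _ _ _ _ _ (is_derive_scale s o); rewrite n1 mulr1.
have : \forall q \near p, 0 < q.2.
  have cq : q.2 @[q --> p] --> p.2 by exact: cvg_snd.
  exact: (cvgr_gt _ cq _ cp.2).
by apply: filterS => q q0; rewrite ext3_radial.
Qed.

(** In the left-invariant frame, differentiating the dual of theta amounts, up to a
    factor, to taking its commutator with theta. Hence the differential and the two
    wedge products in [dA_hodge] vanish by one and the same identity. *)
Lemma hodge_theta_der_tvec x (u a b c : quat R) : dot x x = 1 ->
  hodge_theta_der x (tvec x u).1 (tvec x a) (tvec x b) (tvec x c) =
  - cross u (hodge_theta_coef a b c).
Proof.
move=> x1; rewrite cross_hodge_theta_coef opprK /hodge_theta_der.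
rewrite !theta_tvec2 // !theta_tvec // !crossNl !crossNr !cross_qiml !cross_qimr.
by rewrite -!opprD !cross_derivation !scalerN -!opprD opprK.
Qed.

(** The commutator of imaginary quaternions is twice the cross product. *)
Lemma wedge_flip (k l : R) (a b c d : quat R) :
  qmul (l *: hodge_theta_coef b c d) (k *: qim a) =
  qmul (k *: qim a) (l *: hodge_theta_coef b c d) -
  (2 * (k * l)) *: cross a (hodge_theta_coef b c d).
Proof.
have w0 : hodge_theta_coef b c d 0 0 = 0.
  by rewrite /hodge_theta_coef /cross !quatE; ring.
move: (hodge_theta_coef b c d) w0 => w w0.
by apply: quatP; rewrite /qmul /cross /qim !quatE w0; ring.
Qed.

Lemma dA_hodge_radial f g dg x y (v0 v1 v2 v3 : quat R) :
  cyl (x, y) -> is_derive y 1 g dg ->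
  dA_hodge (radial f) (radial g) (x, y)
     (tvec x v0) (tvec x v1) (tvec x v2) (tvec x v3) = 0.
Proof.
move=> cp gp; have x1 : dot x x = 1 by case: cp.
rewrite /dA_hodge /d3 /wedge13 /wedge31 !hodge1_radial //.
rewrite !(derive_ext3_radial _ _ _ cp (tvec_tangent _ _ _) gp).
rewrite !hodge_theta_tvec // !hodge_theta_der_tvec // /radial !theta_tvec //.
rewrite !wedge_flip /=.
transitivity (
  dg *: alt4 (fun a b c d => a 0 0 *: hodge_theta_coef b c d) v0 v1 v2 v3 +
  (2 * (f y * g y) - g y) *:
    alt4 (fun a b c d => cross a (hodge_theta_coef b c d)) v0 v1 v2 v3);
  last by rewrite alt4_dy_hodge_theta alt4_cross_hodge_theta !scaler0 addr0.
rewrite /alt4 /=.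
do 4 (set c := cross _ (hodge_theta_coef _ _ _); move: c => ?).
do 4 (set c := qmul _ _; move: c => ?).
do 4 (set c := hodge_theta_coef _ _ _; move: c => ?).
by apply: quatP; rewrite !quatE; ring.
Qed.

(** With the left-hand sides written as [sym2], the curvature has coefficients
    (f', 2 f^2 - 2 f), phi /\ phi has (0, 2 g^2), and d_A phi has
    (g', 4 f g - 2 g); the star exchanges the last two. *)
Lemma kapustin_witten_radial (f g df dg : R -> R) :
  (forall y : R, 0 < y -> is_derive y 1 f (df y)) ->
  (forall y : R, 0 < y -> is_derive y 1 g (dg y)) ->
  (forall y : R, 0 < y -> df y = 2 * (2 * f y - 1) * g y) ->
  (forall y : R, 0 < y -> dg y = 2 * (f y ^+ 2 - f y - g y ^+ 2)) ->
  kapustin_witten (radial f) (radial g).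
Proof.
move=> fd gd fE gE; split=> -[x y] cp; have [x1 y0] : dot x x = 1 /\ 0 < y by [].
- move=> u v tu tv; rewrite (tangent_tvec cp tu) (tangent_tvec cp tv).
  move: (coef _ u) (coef _ v) => {tu tv} {}u {}v.
  rewrite (@hodge2_sym2 _ _ _ _ (dg y) (4 * (f y * g y) - 2 * g y)) //; last first.
    move=> a b; rewrite /dA (d1_radial _ _ cp (gd y y0)) !wedge11_radial //.
    by apply: quatP; rewrite !sym2E !quatE; ring.
  rewrite /curvature (d1_radial _ _ cp (fd y y0)) !wedge11_radial //.
  by apply: quatP; rewrite !sym2E !quatE ?(fE y y0) ?(gE y y0); ring.
- move=> v0 v1 v2 v3 t0 t1 t2 t3.
  rewrite (tangent_tvec cp t0) (tangent_tvec cp t1) (tangent_tvec cp t2).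
  rewrite (tangent_tvec cp t3); exact: dA_hodge_radial cp (gd y y0).
Qed.

Lemma curvature_radial f df x y (u v : quat R) : cyl (x, y) ->
  is_derive y 1 f df -> curvature (radial f) (x, y) (tvec x u) (tvec x v) =
  sym2 df (2 * (f y ^+ 2 - f y)) u v.
Proof.
move=> cp fy; have [x1 _] : dot x x = 1 /\ 0 < y by case: cp.
rewrite /curvature (d1_radial _ _ cp fy) wedge11_radial //.
by apply: quatP; rewrite !sym2E !quatE; ring.
Qed.

(** A 2-form with coefficients (a, b) has self-dual and anti-self-dual parts
    ((a + b) / 2, (a + b) / 2) and ((a - b) / 2, (b - a) / 2); the difference of
    their squared norms is 6 a b. *)
Lemma trF2_radial f df x y : cyl (x, y) -> is_derive y 1 f df ->
  trF2 (radial f) (x, y) = 12 * (df * (f y ^+ 2 - f y)).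
Proof.
move=> cp fy; have [x1 _] : dot x x = 1 /\ 0 < y by case: cp.
have FE := fun u v => curvature_radial u v cp fy.
have HE := hodge2_sym2 x1 FE.
set b := 2 * (f y ^+ 2 - f y).
rewrite /trF2 (@normsq2_sym2 _ _ _ _ (2^-1 * (df + b)) (2^-1 * (df + b))); last first.
  move=> u v; rewrite /sd HE FE.
  by apply: quatP; rewrite !sym2E !quatE /b; ring.
rewrite (@normsq2_sym2 _ _ _ _ (2^-1 * (df - b)) (2^-1 * (b - df))); last first.
  move=> u v; rewrite /asd HE FE.
  by apply: quatP; rewrite !sym2E !quatE /b; ring.
by rewrite /b; field.
Qed.

End Equations.

(** * The solution of the ODE system *)

Section Profiles.
Variable R : realType.
Implicit Types (y e : R).

Definition sinh y : R := (expR y - expR (- y)) / 2.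
Definition cosh y : R := (expR y + expR (- y)) / 2.

Lemma is_derive_expRN y : is_derive y 1 (fun t => expR (- t)) (- expR (- y)).
Proof.
have d : is_derive y 1 (-%R : R -> R) (-1) by exact: is_deriveNid.
rewrite -mulN1r; exact: (is_derive_comp d (is_derive_expR (- y))).
Qed.

Lemma is_derive_sinh y : is_derive y 1 sinh (cosh y).
Proof.
rewrite (_ : sinh = 2^-1 \*: (expR - (fun t => expR (- t)))); last first.
  by apply/funext => t; rewrite /sinh mulrC.
have := is_deriveZ 2^-1 (is_deriveB (is_derive_expR y) (is_derive_expRN y)).
by rewrite opprK /cosh mulrC.
Qed.

Lemma is_derive_cosh y : is_derive y 1 cosh (sinh y).
Proof.
rewrite (_ : cosh = 2^-1 \*: (expR + (fun t => expR (- t)))); last first.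
  by apply/funext => t; rewrite /cosh mulrC.
have := is_deriveZ 2^-1 (is_deriveD (is_derive_expR y) (is_derive_expRN y)).
by rewrite /sinh mulrC.
Qed.

Lemma cosh2 y : cosh y ^+ 2 = 1 + sinh y ^+ 2.
Proof.
have : expR y * expR (- y) = 1 by rewrite -expRD subrr expR0.
rewrite /cosh /sinh; move: (expR y) (expR (-y)) => a b ab.
apply/eqP; rewrite -subr_eq0; apply/eqP.
transitivity (a * b - 1); last by rewrite ab subrr.
by field.
Qed.

Lemma sinh0 : sinh 0 = 0.
Proof. by rewrite /sinh oppr0 subrr mul0r. Qed.

Lemma cosh_ge1 y : 1 <= cosh y.
Proof.
have c0 : 0 <= cosh y by rewrite /cosh divr_ge0 // addr_ge0 ?expR_ge0.
have := cosh2 y; have := sqr_ge0 (sinh y); nra.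
Qed.

Lemma ge0_of_derive (F dF : R -> R) : (forall y, is_derive y 1 F (dF y)) ->
  F 0 = 0 -> (forall y, 0 < y -> 0 <= dF y) -> forall y, 0 < y -> 0 <= F y.
Proof.
move=> FdF F0 dF0 y y0.
have cF : {within `[0, y], continuous F}.
  by apply: derivable_within_continuous => z _; apply: ex_derive.
have [c] := MVT y0 (fun z _ => FdF z) cF.
rewrite F0 !subr0 in_itv /= => /andP[c0 _] ->.
by rewrite mulr_ge0 ?dF0 // ltW.
Qed.

Lemma sinh_ge y : 0 < y -> y <= sinh y.
Proof.
rewrite -subr_ge0; apply: (ge0_of_derive (F := fun y => sinh y - y)
  (dF := fun y => cosh y - 1)).
- by move=> z; apply: is_deriveB (is_derive_sinh z) (is_derive_id z 1).
- by rewrite sinh0 subr0.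
- by move=> z _; rewrite subr_ge0 cosh_ge1.
Qed.

Lemma sinh_gt0 y : 0 < y -> 0 < sinh y.
Proof. by move=> y0; apply: lt_le_trans y0 (sinh_ge y0). Qed.

Lemma sinh_le y : 0 < y -> sinh y <= y * cosh y.
Proof.
rewrite -subr_ge0; apply: (ge0_of_derive (F := fun y => y * cosh y - sinh y)
  (dF := fun y => y * sinh y)).
- move=> z.
  have d := is_deriveB (is_deriveM (is_derive_id z 1) (is_derive_cosh z))
    (is_derive_sinh z).
  apply: is_derive_eq d _; rewrite /GRing.scale /=; ring.
- by rewrite sinh0 mul0r subr0.
- by move=> z z0; rewrite mulr_ge0 ?ltW ?sinh_gt0.
Qed.

(** The bound expR y <= 4 on [0, 1] follows from expR (- y / 2) >= 1 - y / 2 >= 1/2. *)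
Lemma cosh_le3 y : 0 < y -> y <= 1 -> cosh y <= 3.
Proof.
move=> y0 y1; have e1 : expR y <= 4.
  have : 1 - y / 2 <= expR (- (y / 2)) by have := expR_ge1Dx (- (y / 2)); lra.
  have ab : expR (y / 2) * expR (- (y / 2)) = 1 by rewrite -expRD subrr expR0.
  have -> : expR y = expR (y / 2) ^+ 2 by rewrite expr2 -expRD -splitr.
  have := expR_ge0 (y/2); have := expR_ge0 (-(y/2)).
  move: ab; move: (expR (y/2)) (expR (-(y/2))) => a b ab a0 b0 hb.
  have : a <= 2 by nra.
  by nra.
have : expR (- y) <= 1 by rewrite -expR0 ler_expR; lra.
by rewrite /cosh; lra.
Qed.

Definition profile_den y : R := 3 + 2 * sinh y ^+ 2.

Lemma profile_den_ge3 y : 3 <= profile_den y.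
Proof. by rewrite /profile_den lerDl mulr_ge0 ?sqr_ge0. Qed.

Lemma profile_den_gt0 y : 0 < profile_den y.
Proof. by apply: lt_le_trans (profile_den_ge3 y). Qed.

Lemma profile_den_neq0 y : profile_den y != 0.
Proof. by rewrite gt_eqF ?profile_den_gt0. Qed.

(** It rises from 0 at y = 0 to the equilibrium value 1/2 at infinity. *)
Definition profile_h y : R := sinh y ^+ 2 / profile_den y.
(** The sign e selects one of the two solutions exchanged by h |-> - h. *)
Definition profile_f e y : R := 2^-1 + e * profile_h y.
Definition profile_g y : R := 3 * cosh y / (2 * sinh y * profile_den y).
Definition profile_dh y : R := 6 * sinh y * cosh y / profile_den y ^+ 2.

Lemma is_derive_div (a b : R -> R) (y da db : R) : b y != 0 ->
  is_derive y 1 a da -> is_derive y 1 b db ->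
  is_derive y 1 (fun t => a t / b t) ((da * b y - a y * db) / b y ^+ 2).
Proof.
move=> b0 ay [dby <-].
have dinv : is_derive y 1 (fun t => (b t)^-1) (- (b y) ^- 2 *: 'D_1 b y).
  by split; [exact: derivableV | rewrite deriveV].
apply: is_derive_eq (is_deriveM ay dinv) _.
by rewrite /GRing.scale /=; field.
Qed.

Lemma is_derive_sqr (f : R -> R) (y df : R) :
  is_derive y 1 f df -> is_derive y 1 (fun t => f t ^+ 2) (2 * f y * df).
Proof.
move=> fd; have d := is_deriveM fd fd.
rewrite (_ : (fun t => f t ^+ 2) = f * f); last first.
  by apply/funext => t; rewrite expr2.
by apply: is_derive_eq d _; rewrite /GRing.scale /=; ring.
Qed.

Lemma is_derive_profile_den y : is_derive y 1 profile_den (4 * sinh y * cosh y).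
Proof.
have d := is_deriveD (is_derive_cst (3 : R) y 1)
  (is_deriveZ (2 : R) (is_derive_sqr (is_derive_sinh y))).
by apply: is_derive_eq d _; rewrite /GRing.scale /=; ring.
Qed.

Lemma is_derive_profile_h y : is_derive y 1 profile_h (profile_dh y).
Proof.
have d := is_derive_div (profile_den_neq0 y)
  (is_derive_sqr (is_derive_sinh y)) (is_derive_profile_den y).
apply: is_derive_eq d _; rewrite /GRing.scale /= /profile_dh /profile_den.
by have := profile_den_neq0 y; rewrite /profile_den => ?; field.
Qed.

Lemma is_derive_profile_f e y : is_derive y 1 (profile_f e) (e * profile_dh y).
Proof.
have d := is_deriveD (is_derive_cst (2^-1 : R) y 1)
  (is_deriveZ e (is_derive_profile_h y)).
by apply: is_derive_eq d _; rewrite add0r.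
Qed.

(** The sign e enters only through f^2 - f = e^2 h^2 - 1/4, so the same g serves
    both solutions. *)
Lemma is_derive_profile_g e y : e ^+ 2 = 1 -> 0 < y ->
  is_derive y 1 profile_g
    (2 * (profile_f e y ^+ 2 - profile_f e y - profile_g y ^+ 2)).
Proof.
move=> e2 y0; have s0 : sinh y != 0 by rewrite gt_eqF ?sinh_gt0.
have d2 : is_derive y 1 (fun t => 2 * sinh t * profile_den t)
    (2 * cosh y * profile_den y + 2 * sinh y * (4 * sinh y * cosh y)).
  have d := is_deriveM (is_deriveZ (2 : R) (is_derive_sinh y))
    (is_derive_profile_den y).
  by apply: is_derive_eq d _; rewrite /GRing.scale /= /GRing.scale /=; ring.
have b0 : 2 * sinh y * profile_den y != 0.
  by apply: mulf_neq0 (profile_den_neq0 y); apply: mulf_neq0 s0; rewrite pnatr_eq0.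
have d := is_derive_div (b := fun t => 2 * sinh t * profile_den t) b0
  (is_deriveZ (3 : R) (is_derive_cosh y)) d2.
apply: is_derive_eq d _; rewrite /GRing.scale /=.
have -> : profile_f e y ^+ 2 - profile_f e y = e ^+ 2 * profile_h y ^+ 2 - 4^-1.
  by rewrite /profile_f; field.
rewrite e2 mul1r /profile_h /profile_g.
have D0 := profile_den_neq0 y; have c2 := cosh2 y.
apply/eqP; rewrite -subr_eq0; apply/eqP.
rewrite /profile_den in b0 D0 *.
move: (sinh y) (cosh y) s0 b0 D0 c2 => s c s0 b0 D0 c2.
(* An intermediate form polynomial in c^2, where c^2 = 1 + s^2 can be used. *)
transitivity ((6 * s ^+ 2 * (3 + 2 * s ^+ 2) - 3 * c ^+ 2 * (6 + 12 * s ^+ 2)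
    + 18 * c ^+ 2) / (2 * s * (3 + 2 * s ^+ 2)) ^+ 2
  - 2 * ((s ^+ 2 / (3 + 2 * s ^+ 2)) ^+ 2 - 4^-1)).
  by rewrite /GRing.scale /=; field; rewrite D0.
by rewrite c2; field; rewrite D0.
Qed.

(** This is h' = 4 h g. *)
Lemma profile_f_ode e y : 0 < y ->
  e * profile_dh y = 2 * (2 * profile_f e y - 1) * profile_g y.
Proof.
move=> y0; have s0 : sinh y != 0 by rewrite gt_eqF ?sinh_gt0.
rewrite /profile_dh /profile_f /profile_g /profile_h; have := profile_den_neq0 y.
move: (profile_den y) => D D0; field. by rewrite D0 s0.
Qed.

Lemma profile_h_bound y : 0 < y -> y <= 1 -> `|profile_h y| <= 3 * y ^+ 2.
Proof.
move=> y0 y1; rewrite ger0_norm; last first.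
  by rewrite /profile_h divr_ge0 ?sqr_ge0 // ltW ?profile_den_gt0.
rewrite /profile_h ler_pdivrMr ?profile_den_gt0 //.
have := profile_den_ge3 y; have := sinh_le y0; have := sinh_gt0 y0.
have := cosh_le3 y0 y1.
move: (profile_den y) (sinh y) (cosh y) => D s c c3 s0 sc D3.
have s3 : s <= 3 * y by nra.
apply: (@le_trans _ _ (9 * y ^+ 2)); first by nra.
have : 0 <= y ^+ 2 by exact: sqr_ge0.
by nra.
Qed.

(** The difference equals (3 (y cosh y - sinh y) - 2 sinh^3 y) / (2 y sinh y D) with
    D = [profile_den]: the numerator is cubic in y and the denominator quadratic. *)
Lemma profile_g_bound y : 0 < y -> y <= 1 -> `|profile_g y - y^-1 / 2| <= 9 * y.
Proof.
move=> y0 y1; have D3 := profile_den_ge3 y; have sc := sinh_le y0.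
have s0 := sinh_gt0 y0.
have c3 := cosh_le3 y0 y1; have ys := sinh_ge y0; have c1 := cosh_ge1 y.
have c2 := cosh2 y; have D0 := profile_den_gt0 y.
have b0 : 0 < 2 * sinh y * y * profile_den y.
  by apply: mulr_gt0 => //; apply: mulr_gt0 => //; apply: mulr_gt0.
have -> : profile_g y - y^-1 / 2 =
    (3 * (y * cosh y - sinh y) - 2 * sinh y ^+ 3) / (2 * sinh y * y * profile_den y).
  rewrite /profile_g; have : profile_den y = 3 + 2 * sinh y ^+ 2 by [].
  move: (profile_den y) D0 {D3 b0} => D D0 DE.
  have s0' : sinh y != 0 by rewrite gt_eqF.
  have y0' : y != 0 by rewrite gt_eqF.
  have D0' : D != 0 by rewrite gt_eqF.
  transitivity ((3 * y * cosh y - sinh y * D) / (2 * sinh y * y * D)).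
    by field; rewrite D0' s0' y0'.
  by congr (_ / _); rewrite DE; ring.
rewrite normrM normfV (gtr0_norm b0) ler_pdivrMr //.
move: (profile_den y) (sinh y) (cosh y) D3 sc s0 c3 ys c1 c2 {b0 D0}.
move=> D s c D3 sc s0 c3 ys c1 c2.
have s3 : s <= 3 * y by nra.
have c1s : 2 * (c - 1) <= s ^+ 2 by nra.
have ss : s ^+ 2 <= 9 * y ^+ 2 by nra.
have sss : s ^+ 3 <= 27 * y ^+ 3.
  by rewrite !exprS expr0; nra.
have s3g : 0 <= s ^+ 3 by rewrite exprn_ge0 // ltW.
(* From s >= y and 2 (c - 1) <= s^2 <= 9 y^2; the constant 27/2 is rounded up. *)
have up : 3 * (y * c - s) <= 14 * y ^+ 3.
  have : 3 * (y * c - s) <= 3 * y * (c - 1) by nra.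
  have : 3 * y * (c - 1) <= 14 * y ^+ 3.
    have -> : 14 * y ^+ 3 = y * (14 * y ^+ 2) by ring.
    have -> : 3 * y * (c - 1) = y * (3 * (c - 1)) by ring.
    by rewrite ler_pM2l //; have := sqr_ge0 y; lra.
  by lra.
apply: (@le_trans _ _ (54 * y ^+ 3)).
  have y3 : 0 <= y ^+ 3 by rewrite exprn_ge0 // ltW.
  by rewrite ler_norml; apply/andP; split; nra.
have -> : 54 * y ^+ 3 = 9 * y * (2 * y * y * 3) by ring.
apply: ler_wpM2l; first by rewrite mulr_ge0 // ltW.
have a : y * y <= s * y by rewrite ler_pM2r.
have yy : 0 < y * y by rewrite mulr_gt0.
have : y * y * 3 <= s * y * D by apply: ler_pM => //; exact: ltW.
by lra.
Qed.

End Profiles.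

(** * Smoothness of elementary functions *)

Section Smoothness.
Variable R : realType.

Lemma near_cyl_nbhd (p : ambient R) : cyl_nbhd p -> \forall q \near p, cyl_nbhd q.
Proof.
move=> [p1 p2].
have c1 : q.1 @[q --> p] --> p.1 by exact: cvg_fst.
have c2 : q.2 @[q --> p] --> p.2 by exact: cvg_snd.
have n1 := cvgr_neq0 _ c1 p1.
have n2 := cvgr_gt _ c2 _ p2.
by near=> q; split; near: q; [exact: n1 | exact: n2].
Unshelve. all: by end_near. Qed.

(** Differentiability is local. It is needed to pass from a function to a formula
    valid only on the open set [cyl_nbhd]. *)
Lemma near_eq_differentiable (V W : normedModType R) (f g : V -> W) (x : V) :
  (\near x, f x = g x) -> differentiable f x -> differentiable g x.
Proof.
move=> fg fx; have [dfc dfE] := (diff_locallyP x f).1 fx.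
have gE : g \o shift x = cst (g x) + 'd f x +o_ (0 : V) id.
  apply/eqaddoP => e e0.
  have /eqaddoP /(_ e e0) fo := dfE.
  have sfg : \forall h \near (0 : V), f (h + x) = g (h + x).
    have cx : h + x @[h --> (0 : V)] --> x.
      by rewrite -[X in _ --> X]add0r; apply: cvgD; [exact: cvg_id | exact: cvg_cst].
    exact: cx fg.
  near=> h.
  have -> : (g \o shift x - (cst (g x) + 'd f x)) h =
      (f \o shift x - (cst (f x) + 'd f x)) h.
    rewrite !fctE /= (nbhs_singleton fg); congr (_ - _).
    by apply/esym; near: h.
  by near: h.
apply/diff_locallyP.
by rewrite (diff_unique dfc gE).
Unshelve. all: by end_near. Qed.

(** A class of real functions on [cyl_nbhd], stable under directional derivatives
    and rich enough to contain the coefficients of the solutions. Inverses and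
    square roots carry the side conditions that make them differentiable there. *)
Inductive elementary : (ambient R -> R) -> Prop :=
| elementary_cst c : elementary (fun=> c)
| elementary_coord i : elementary (fun q => q.1 0 i)
| elementary_snd : elementary (fun q => q.2)
| elementary_add f g : elementary f -> elementary g ->
    elementary (fun q => f q + g q)
| elementary_mul f g : elementary f -> elementary g ->
    elementary (fun q => f q * g q)
| elementary_inv f : elementary f -> (forall q, cyl_nbhd q -> f q != 0) ->
    elementary (fun q => (f q)^-1)
| elementary_sqrt f : elementary f -> (forall q, cyl_nbhd q -> 0 < f q) ->
    elementary (fun q => Num.sqrt (f q))
| elementary_exp f : elementary f -> elementary (fun q => expR (f q)).

Lemma elementary_differentiable f : elementary f ->
  forall q, cyl_nbhd q -> differentiable f q.
Proof.
elim=> {f} [c|i||f g _ fd _ gd|f g _ fd _ gd|f _ fd f0|f _ fd f0|f _ fd] q Uq.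
- exact: differentiable_cst.
- apply: (differentiable_comp (f := fst) (g := fun x : quat R => x 0 i)).
    by apply: linear_differentiable => z; exact: cvg_fst.
  exact: differentiable_coord.
- by apply: linear_differentiable => z; exact: cvg_snd.
- by apply: differentiableD; auto.
- by apply: differentiableM; auto.
- by apply: differentiableV; auto.
- apply: (differentiable_comp (g := Num.sqrt)); first exact: fd.
  by apply/derivable1_diffP; apply: ex_derive; apply: is_derive1_sqrt; exact: f0.
- apply: (differentiable_comp (g := expR)); first exact: fd.
  by apply/derivable1_diffP; apply: ex_derive.
Qed.

(** Each differentiation rule stays inside the class. The equality holds only on
    [cyl_nbhd], outside of which the derivative is uncontrolled. *)
Lemma elementary_derive f v : elementary f ->
  exists2 g, elementary g & forall q, cyl_nbhd q -> 'D_v f q = g q.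
Proof.
have Dd h q : elementary h -> cyl_nbhd q -> derivable h q v.
  by move=> eh Uq; apply: diff_derivable; exact: elementary_differentiable.
elim=> {f} [c|i||f g ef [f' ef' fE] eg [g' eg' gE]|f g ef [f' ef' fE] eg [g' eg' gE]
  |f ef [f' ef' fE] f0|f ef [f' ef' fE] f0|f ef [f' ef' fE]].
- exists (fun=> 0); first exact: elementary_cst.
  by move=> q _; exact: derive_cst.
- exists (fun=> v.1 0 i); first exact: elementary_cst.
  move=> q _; apply: derive_val.
  apply: (@is_derive_linear _ _ _ (fun q : ambient R => q.1 0 i)) => k a b.
  by rewrite !mxE.
- exists (fun=> v.2); first exact: elementary_cst.
  move=> q _; apply: derive_val.
  exact: (@is_derive_linear _ _ _ (fun q : ambient R => q.2)).
- exists (fun q => f' q + g' q); first exact: elementary_add.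
  by move=> q Uq; rewrite -fE // -gE // -deriveD //; exact: Dd.
- exists (fun q => f q * g' q + g q * f' q).
    by apply: elementary_add; exact: elementary_mul.
  move=> q Uq; rewrite -fE // -gE //.
  by apply: (deriveM (f := f) (g := g)); exact: Dd.
- exists (fun q => (- 1 * ((f q)^-1 * (f q)^-1)) * f' q).
    apply: elementary_mul => //; apply: elementary_mul; first exact: elementary_cst.
    by apply: elementary_mul; exact: elementary_inv.
  move=> q Uq; rewrite deriveV ?f0 //; last exact: Dd.
  by rewrite -fE // /GRing.scale /= -exprVn expr2 mulN1r.
- exists (fun q => f' q * (2 * Num.sqrt (f q))^-1).
    apply: elementary_mul => //; apply: elementary_inv => [|q Uq].
      by apply: elementary_mul; [exact: elementary_cst|exact: elementary_sqrt].
    by rewrite mulf_neq0 ?pnatr_eq0 // gt_eqF // sqrtr_gt0 f0.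
  move=> q Uq; apply: derive_val; apply: is_derive_comp.
    by rewrite -fE //; apply: derivableP; exact: Dd.
  exact/is_derive1_sqrt/f0.
- exists (fun q => f' q * expR (f q)).
    by apply: elementary_mul => //; exact: elementary_exp.
  move=> q Uq; apply: derive_val; apply: is_derive_comp.
  by rewrite -fE //; apply: derivableP; exact: Dd.
Qed.

Lemma rV_differentiable (F : ambient R -> quat R) q :
  (forall i, differentiable (fun x => F x 0 i) q) -> differentiable F q.
Proof.
move=> Fd; rewrite (_ : F = \sum_(i < 4) (fun x => F x 0 i *: delta_mx 0 i)).
  by apply: differentiable_sum => i; exact: differentiableZl.
by apply/funext => x; rewrite fct_sumE [LHS]row_sum_delta.
Qed.

(** By induction on n, since by [elementary_derive] the hypothesis passes to every
    directional derivative. *)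
Lemma elementary_Cn n (F : ambient R -> quat R) :
  (forall i, exists2 g, elementary g & forall q, cyl_nbhd q -> F q 0 i = g q) ->
  Cn n (@cyl_nbhd R) F.
Proof.
elim: n F => [|n IH] F FE.
all: have Fd q : cyl_nbhd q -> differentiable F q.
1,3: move=> Uq; apply: rV_differentiable => i; have [g eg gE] := FE i;
  apply: (near_eq_differentiable (f := g));
  [by apply: filterS (near_cyl_nbhd Uq) => z Uz; rewrite gE
  |exact: elementary_differentiable].
  by move=> q Uq; apply: differentiable_continuous; exact: Fd.
split=> // v; apply: IH => i.
have [g eg gE] := FE i; have [g' eg' g'E] := elementary_derive v eg.
exists g' => // q Uq; rewrite derive_mx ?mxE; last exact/diff_derivable/Fd.
rewrite -g'E //; apply: near_eq_derive.
by apply: filterS (near_cyl_nbhd Uq) => z Uz; rewrite gE.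
Qed.

Definition elementary_profile (f : R -> R) :=
  exists2 g, elementary g & forall q, cyl_nbhd q -> f q.2 = g q.

Lemma su2_form1_radial (f : R -> R) : elementary_profile f -> su2_form1 (radial f).
Proof.
case=> g eg gE; split=> [p _ v _|p _ k u v _ _|v n].
- by rewrite /imaginary /radial /theta /qim !quatE mulr0.
- by rewrite /radial /= theta_linr scalerDr !scalerA mulrC.
have e_norm : elementary (fun q : ambient R => (qabs q.1)^-1).
  have edot : elementary (fun q : ambient R => dot q.1 q.1).
    under eq_fun do rewrite dotE.
    by do !apply: elementary_add; apply: elementary_mul; exact: elementary_coord.
  apply: elementary_inv => [|q [q0 _]].
    by apply: elementary_sqrt edot _ => q [q0 _]; exact: dot_gt0.
  by rewrite gt_eqF // sqrtr_gt0 dot_gt0.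
have e_theta j : elementary (fun q : ambient R => theta q.1 v.1 0 j).
  have c i a : elementary (fun q : ambient R => q.1 0 i * a).
    by apply: elementary_mul; [exact: elementary_coord|exact: elementary_cst].
  have cN i a : elementary (fun q : ambient R => - (q.1 0 i * a)).
    by under eq_fun do rewrite -mulrN; exact: c.
  under eq_fun do rewrite thetaE.
  move: j; apply: ord4E; under eq_fun do rewrite !mkquatE.
    exact: elementary_cst.
  1-3: by do !apply: elementary_add.
apply: elementary_Cn => i.
exists (fun q => (g q * (qabs q.1)^-1) * theta q.1 v.1 0 i).
  by apply: elementary_mul (e_theta i); exact: elementary_mul.
by move=> q Uq; rewrite ext1_radial quatZ gE.
Qed.

End Smoothness.

(** * Smoothness of the solutions and the Nahm pole *)

Section Nahm.
Variable R : realType.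

Lemma elementary_sinh_cosh : elementary (fun q : ambient R => sinh q.2) /\
  elementary (fun q : ambient R => cosh q.2).
Proof.
have ep : elementary (fun q : ambient R => expR q.2).
  exact/elementary_exp/elementary_snd.
have em : elementary (fun q : ambient R => expR (- q.2)).
  apply: elementary_exp; under eq_fun do rewrite -mulN1r.
  exact: elementary_mul (elementary_cst _) (elementary_snd _).
split; rewrite /sinh /cosh; apply: elementary_mul (elementary_cst _) => /=;
  apply: elementary_add => //.
under eq_fun do rewrite -mulN1r.
exact: elementary_mul (elementary_cst _) em.
Qed.

Lemma elementary_profile_den : elementary (fun q : ambient R => profile_den q.2).
Proof.
have [es _] := elementary_sinh_cosh; rewrite /profile_den.
apply: elementary_add (elementary_cst _) _.
by apply: elementary_mul (elementary_cst _) _; exact: elementary_mul.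
Qed.

Lemma elementary_profile_cst (c : R) : elementary_profile (fun=> c).
Proof. by exists (fun=> c) => //; exact: elementary_cst. Qed.

Lemma elementary_profile_f e : elementary_profile (@profile_f R e).
Proof.
have [es _] := elementary_sinh_cosh.
exists (fun q : ambient R => profile_f e q.2) => //; rewrite /profile_f /profile_h.
apply: elementary_add (elementary_cst _) _.
apply: elementary_mul (elementary_cst _) _; apply: elementary_mul.
  exact: elementary_mul.
by apply: elementary_inv elementary_profile_den _ => q _; exact: profile_den_neq0.
Qed.

Lemma elementary_profile_g : elementary_profile (@profile_g R).
Proof.
have [es ec] := elementary_sinh_cosh.
exists (fun q : ambient R => profile_g q.2) => //; rewrite /profile_g.
apply: elementary_mul; first exact: elementary_mul (elementary_cst _) _.
apply: elementary_inv => [|q [_ q0]].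
  apply: elementary_mul elementary_profile_den.
  exact: elementary_mul (elementary_cst _) _.
apply: mulf_neq0 (profile_den_neq0 _).
by rewrite mulf_neq0 ?pnatr_eq0 // gt_eqF // sinh_gt0.
Qed.

Lemma qabsZ (k : R) (p : quat R) : qabs (k *: p) = `|k| * qabs p.
Proof.
rewrite /qabs -sqrtr_sqr -sqrtrM ?sqr_ge0 //; congr Num.sqrt.
by rewrite !dotE !quatE; ring.
Qed.

(** By the four-square identity the squared norm of the conjugate of x times v is
    |x|^2 |v|^2, and its real part is the inner product of x and v. *)
Lemma qabs_theta_le1 x (v : ambient R) : sphere3 x -> dot x v.1 = 0 ->
  dot v.1 v.1 + v.2 ^+ 2 <= 1 -> qabs (theta x v.1) <= 1.
Proof.
move=> x1 xv v1; rewrite -sqrtr1 /qabs ler_sqrt //.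
have -> : dot (theta x v.1) (theta x v.1) = dot x x * dot v.1 v.1 - dot x v.1 ^+ 2.
  by rewrite thetaE !dotE !quatE; ring.
rewrite [dot x x]x1 xv expr0n subr0 mul1r.
by apply: le_trans v1; rewrite lerDl sqr_ge0.
Qed.

Lemma ord3E (P : 'I_3 -> Prop) : P 0 -> P 1 -> P 2 -> forall i, P i.
Proof.
move=> P0 P1 P2 [[|[|[|//]]] i_lt3].
- by rewrite (_ : Ordinal _ = 0) //; apply/val_inj.
- by rewrite (_ : Ordinal _ = 1) //; apply/val_inj.
- by rewrite (_ : Ordinal _ = 2) //; apply/val_inj.
Qed.

(** The units I, J, K, indexed from 0. *)
Definition imag_unit (a : 'I_3) : quat R := delta_mx 0 (lift 0 a).

Lemma imag_unitE : ((imag_unit 0 = mkquat 0 1 0 0) * (imag_unit 1 = mkquat 0 0 1 0) *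
  (imag_unit 2 = mkquat 0 0 0 1))%type.
Proof. by refine (_, _, _); apply: quatP; rewrite !quatE. Qed.

Lemma left_frame_orthonormal (x : quat R) : sphere3 x ->
  orthonormal_tangent_basis x (fun a => qmul x (imag_unit a)).
Proof.
move=> x1; split.
  by apply: ord3E; rewrite imag_unitE dotE /qmul !quatE; ring.
have E p q : dot (qmul x p) (qmul x q) = dot p q.
  by rewrite -[RHS]mul1r -x1 !dotE /qmul !quatE; ring.
by apply: ord3E; apply: ord3E; rewrite E !imag_unitE dotE !quatE /=; ring.
Qed.

Lemma half_units_su2 : su2_triple (fun a => 2^-1 *: imag_unit a).
Proof.
split; first by move=> a; rewrite /imaginary !quatE mulr0.
have a1 : (1 + 1 = 2 :> 'I_3) by apply/val_inj.
have a2 : (1 + 2 = 0 :> 'I_3) by apply/val_inj.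
have a3 : (2 + 1 = 0 :> 'I_3) by apply/val_inj.
have a4 : (2 + 2 = 1 :> 'I_3) by apply/val_inj.
by apply: ord3E; rewrite ?add0r ?(a1, a2, a3, a4) !imag_unitE;
   apply: quatP; rewrite /qcomm /qmul !quatE; field.
Qed.

Lemma theta_frame x (v : quat R) :
  \sum_(a < 3) dot (qmul x (imag_unit a)) v *: (2^-1 *: imag_unit a) =
  2^-1 *: theta x v.
Proof.
rewrite (_ : \sum_(a < 3) _ = \sum_(a <- [:: 0; 1; 2])
    dot (qmul x (imag_unit a)) v *: (2^-1 *: imag_unit a)); last first.
  rewrite !big_ord_recr big_ord0 !big_cons big_nil /= add0r addr0 addrA.
  by congr (dot (qmul _ (imag_unit _)) _ *: (_ *: imag_unit _) +
    dot (qmul _ (imag_unit _)) _ *: (_ *: imag_unit _) +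
    dot (qmul _ (imag_unit _)) _ *: (_ *: imag_unit _)); apply/val_inj.
rewrite !big_cons big_nil !imag_unitE thetaE !dotE.
by apply: quatP; rewrite /qmul !quatE; ring.
Qed.

(** Both error estimates reduce to those of the profiles because |theta(v)| <= 1 on
    unit vectors. *)
Lemma nahm_pole_profiles e : e ^+ 2 = 1 ->
  nahm_pole (radial (@profile_f R e)) (radial (@profile_g R)).
Proof.
move=> e2.
have e1 : `|e| = 1.
  by apply/eqP; rewrite -(@eqrXn2 _ 2) // ?expr1n -?normrX ?e2 ?normr1.
exists (fun x a => qmul x (imag_unit a)), (fun _ a => 2^-1 *: imag_unit a).
exists (fun x v => 0 *: theta x v.1), (fun x v => 2^-1 *: theta x v.1).
exists (fun x v => 0 *: theta x v.1); split.
- exact: left_frame_orthonormal.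
- by move=> x _; exact: half_units_su2.
- split; exact: (su2_form1_radial (elementary_profile_cst _)).
- move=> eps eps0; near=> y.
  have y0 : 0 < y by near: y; exact: nbhs_right_gt.
  have y1 : y <= 1 by near: y; exact: nbhs_right_le.
  have ye : y <= eps / 9 by near: y; apply: nbhs_right_le; rewrite divr_gt0.
  move=> x v x1 xv v1; rewrite theta_frame scale0r subr0 scalerA -scalerBl.
  rewrite qabsZ; apply: (@le_trans _ _ (9 * y * 1)).
    by apply: ler_pM; rewrite ?profile_g_bound ?qabs_theta_le1 // sqrtr_ge0.
  by lra.
- move=> eps eps0; near=> y.
  have y0 : 0 < y by near: y; exact: nbhs_right_gt.
  have y1 : y <= 1 by near: y; exact: nbhs_right_le.
  have ye : y <= eps / 3 by near: y; apply: nbhs_right_le; rewrite divr_gt0.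
  move=> x v x1 xv v1; rewrite scale0r scaler0 subr0 /radial -scalerBl.
  rewrite /profile_f addrAC subrr add0r qabsZ normrM e1 mul1r.
  apply: (@le_trans _ _ (3 * y ^+ 2 * 1)).
    by apply: ler_pM; rewrite ?profile_h_bound ?qabs_theta_le1 // sqrtr_ge0.
  by rewrite mulr1; nra.
Unshelve. all: by end_near. Qed.

End Nahm.

(** * The volume density in hyperspherical angles *)

Section Density.
Variable R : realType.

Lemma is_derive_pair (V W1 W2 : normedModType R) (F : V -> W1) (G : V -> W2)
    (p u : V) dF dG :
  is_derive p u F dF -> is_derive p u G dG ->
  is_derive p u (fun q => (F q, G q)) (dF, dG).
Proof.
move=> [Fd <-] [Gd <-].
have c : h^-1 *: (((fun q => (F q, G q)) \o shift p) (h *: u) - (F p, G p))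
    @[h --> 0^'] --> ('D_u F p, 'D_u G p).
  exact: (cvg_pair Fd Gd).
by split; [apply/cvg_ex; exists ('D_u F p, 'D_u G p) | apply/cvg_lim].
Qed.

(** Reduces the partial derivatives of [param] to those of real functions. *)
Lemma is_derive_mkquat (a b c d : R -> R) (t da db dc dd : R) :
  is_derive t 1 a da -> is_derive t 1 b db -> is_derive t 1 c dc ->
  is_derive t 1 d dd ->
  is_derive t 1 (fun t => mkquat (a t) (b t) (c t) (d t)) (mkquat da db dc dd).
Proof.
move=> ha hb hc hd; apply: is_derive_rV; apply: ord4E; rewrite mkquatE;
  by under eq_fun do rewrite mkquatE.
Qed.

Lemma is_derive_mulr (f : R -> R) (k t df : R) :
  is_derive t 1 f df -> is_derive t 1 (fun t => f t * k) (df * k).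
Proof.
move=> fd; have d := is_deriveM fd (is_derive_cst k t 1).
by apply: is_derive_eq d _; rewrite scaler0 add0r /GRing.scale /= mulrC.
Qed.

Lemma is_derive_mull (f : R -> R) (k t df : R) :
  is_derive t 1 f df -> is_derive t 1 (fun t => k * f t) (k * df).
Proof.
move=> fd; have d := is_derive_mulr k fd.
rewrite (_ : (fun t => _) = (fun t => f t * k)); last first.
  by apply/funext => ?; rewrite mulrC.
by rewrite [k * df]mulrC.
Qed.

(** Differentiates a product of sines and cosines in which one factor varies. *)
Ltac derive_factors := do ?[exact: is_derive_cst | exact: is_derive_sin
  | exact: is_derive_cos | apply: is_derive_mulr | apply: is_derive_mull].

(** The four rows of the determinant are pairwise orthogonal, of lengths 1, sin c,
    sin c sin t and 1. *)
Lemma param_densityE (c t s y : R) : 0 < c < pi -> 0 < t < pi ->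
  param_density c t s y = sin c ^+ 2 * sin t.
Proof.
move=> c_itv t_itv.
rewrite /param_density.
have dc : derive1 (fun c' => param c' t s y) c =
    (mkquat (- sin c) (cos c * cos t) (cos c * sin t * cos s)
       (cos c * sin t * sin s), 0).
  rewrite derive1E; apply: derive_val; apply: is_derive_pair.
  by apply: is_derive_mkquat; derive_factors.
have dt : derive1 (fun t' => param c t' s y) t =
    (mkquat 0 (sin c * - sin t) (sin c * cos t * cos s)
       (sin c * cos t * sin s), 0).
  rewrite derive1E; apply: derive_val; apply: is_derive_pair.
  by apply: is_derive_mkquat; derive_factors.
have ds : derive1 (fun s' => param c t s' y) s =
    (mkquat 0 0 (sin c * sin t * - sin s) (sin c * sin t * cos s), 0).
  rewrite derive1E; apply: derive_val; apply: is_derive_pair.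
  by apply: is_derive_mkquat; derive_factors.
have dy : derive1 (fun y' => param c t s y') y = (0, 1).
  rewrite derive1E; apply: derive_val; apply: is_derive_pair.
rewrite dc dt ds dy /vol /param /=.
set M := \matrix_(_, _) _.
have -> : M = \matrix_(i < 4, j < 4)
   (nth 0 [::
     mkquat (- sin c) (cos c * cos t) (cos c * sin t * cos s)
       (cos c * sin t * sin s);
     mkquat 0 (sin c * - sin t) (sin c * cos t * cos s)
       (sin c * cos t * sin s);
     mkquat 0 0 (sin c * sin t * - sin s) (sin c * sin t * cos s);
     mkquat (cos c) (sin c * cos t) (sin c * sin t * cos s)
       (sin c * sin t * sin s)] i) 0 j.
  apply/matrixP => i j; rewrite mxE [RHS]mxE.
  by elim/ord4E: i; rewrite /= ?modn_small //= ?scale0r ?addr0 ?scale1r ?add0r.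
rewrite det4E /= !mkquatE.
have [c0 cpi] := andP c_itv; have [t0 tpi] := andP t_itv.
have sc0 : 0 < sin c by exact: sin_gt0_pi.
have st0 : 0 < sin t by exact: sin_gt0_pi.
have sqE a : cos a ^+ 2 = 1 - sin a ^+ 2 :> R by rewrite -(cos2Dsin2 a) addrK.
rewrite (_ : _ - _ = - (sin c ^+ 2 * sin t)).
  by rewrite normrN ger0_norm // mulr_ge0 ?sqr_ge0 // ltW.
have := sqE c; have := sqE t; have := sqE s.
move: (cos c) (sin c) (cos t) (sin t) (cos s) (sin s) => C S C' S' C'' S'' e3 e2 e1.
(* Each bracket is cos^2 + sin^2 = 1. *)
transitivity (- ((C'' ^+ 2 + S'' ^+ 2) * (C' ^+ 2 + S' ^+ 2) * (C ^+ 2 + S ^+ 2) *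
  (S ^+ 2 * S'))); first by ring.
by rewrite e1 e2 e3 !subrK !mul1r.
Qed.

Lemma param_cyl (c t s y : R) : 0 < y -> cyl (param c t s y).
Proof.
move=> y0; split=> //=; rewrite /sphere3 /= dotE !mkquatE.
transitivity (cos c ^+ 2 + sin c ^+ 2 * (cos t ^+ 2 + sin t ^+ 2 *
   (cos s ^+ 2 + sin s ^+ 2))); first by ring.
by rewrite !cos2Dsin2 mulr1 cos2Dsin2 mulr1 cos2Dsin2.
Qed.

End Density.

(** * Sigma-finiteness of product measures *)

Section ProductMeasure.
Local Open Scope ereal_scope.
Context d1 d2 (T1 : measurableType d1) (T2 : measurableType d2) (R : realType).
Variable m1 : {sigma_finite_measure set T1 -> \bar R}.
Variable m2 : {sigma_finite_measure set T2 -> \bar R}.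

(** Two increasing covers by sets of finite measure give the cover by the products
    F_n x G_n; monotonicity is what makes a single index sufficient. *)
Lemma sigma_finite_prod : sigma_finite setT (m1 \x m2).
Proof.
have [F [FT Fhomo Ffin]] := (sigma_finiteP _ _).1 (sigma_finiteT m1).
have [G [GT Ghomo Gfin]] := (sigma_finiteP _ _).1 (sigma_finiteT m2).
exists (fun n => F n `*` G n) => [|n]; last first.
  have [[mF Foo] [mG Goo]] := (Ffin n, Gfin n); split; first exact: measurableX.
  by rewrite [ltLHS]product_measure1E // lte_mul_pinfty // ge0_fin_numE.
apply/seteqP; split=> // -[x y] _.
have [i _ Fix] : (\bigcup_i F i) x by rewrite -FT.
have [j _ Gjy] : (\bigcup_i G i) y by rewrite -GT.
exists (maxn i j) => //; split => /=.
- exact: (subsetPset _ _ (Fhomo _ _ (leq_maxl i j))).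
- exact: (subsetPset _ _ (Ghomo _ _ (leq_maxr i j))).
Qed.

(** A name for the product measure, to which the structure of a sigma-finite measure
    is attached, so that products can be iterated. *)
Definition prod_measure : set (T1 * T2) -> \bar R := m1 \x m2.
HB.instance Definition _ := Measure.on prod_measure.
HB.instance Definition _ :=
  Measure_isSigmaFinite.Build _ _ _ prod_measure sigma_finite_prod.

End ProductMeasure.

(** * One-dimensional integrals and products *)

Section Integration.
Variable R : realType.
Local Open Scope ereal_scope.

(** Tonelli's theorem for a function that separates the variables, after extension
    by zero outside A x B. *)
Lemma integral_prod_tensor d1 d2 (T1 : measurableType d1) (T2 : measurableType d2)
    (m1 : {sigma_finite_measure set T1 -> \bar R})
    (m2 : {sigma_finite_measure set T2 -> \bar R})
    (A : set T1) (B : set T2) (a : T1 -> R) (b : T2 -> R) :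
  measurable A -> measurable B -> measurable_fun A a -> measurable_fun B b ->
  (forall x, A x -> 0 <= a x)%R -> (forall y, B y -> 0 <= b y)%R ->
  \int[m1 \x m2]_(z in A `*` B) (a z.1 * b z.2)%:E =
  (\int[m1]_(x in A) (a x)%:E) * (\int[m2]_(y in B) (b y)%:E).
Proof.
move=> mA mB ma mb a0 b0.
have a0' x : (0 <= (a \_ A) x)%R by rewrite patchE; case: ifPn => // /set_mem /a0.
have b0' y : (0 <= (b \_ B) y)%R by rewrite patchE; case: ifPn => // /set_mem /b0.
have ma' : measurable_fun setT (a \_ A) by exact/(measurable_restrictT _ mA).
have mb' : measurable_fun setT (b \_ B) by exact/(measurable_restrictT _ mB).
rewrite integral_mkcond.
rewrite (_ : _ \_ _ = fun z => ((a \_ A) z.1 * (b \_ B) z.2)%:E); last first.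
  apply/funext => -[x y]; rewrite !patchE in_setX /=.
  by case: (x \in A); case: (y \in B); rewrite /= ?mulr0 ?mul0r.
rewrite fubini_tonelli1; first last.
- by move=> z; rewrite lee_fin mulr_ge0.
- by apply/measurable_EFinP; apply: measurable_funM; apply: measurableT_comp.
rewrite /fubini_F /=.
have mEb : measurable_fun setT (EFin \o (b \_ B)) by exact/measurable_EFinP.
have mEa : measurable_fun setT (EFin \o (a \_ A)) by exact/measurable_EFinP.
have inner x : \int[m2]_y ((a \_ A) x * (b \_ B) y)%:E =
    ((a \_ A) x)%:E * \int[m2]_(y in B) (b y)%:E.
  under eq_integral => y _ do rewrite EFinM.
  rewrite [in RHS]integral_mkcond restrict_EFin.
  rewrite (ge0_integralZl m2 measurableT mEb) //.
  - by move=> y _; rewrite lee_fin; exact: b0'.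
  - by rewrite lee_fin; exact: a0'.
under eq_integral => x _ do rewrite inner.
rewrite (ge0_integralZr m1 measurableT mEa).
- by congr (_ * _); rewrite [RHS]integral_mkcond restrict_EFin.
- by move=> x _; rewrite lee_fin; exact: a0'.
- by apply: integral_ge0 => y By; rewrite lee_fin b0.
Qed.

Local Open Scope ring_scope.
Local Notation mu := (@lebesgue_measure R).

Lemma integral_oo_derive (F f : R -> R) (a b : R) : (a < b)%R ->
  (forall x : R, is_derive x 1 F (f x)) -> continuous f ->
  (\int[mu]_(x in `]a, b[) (f x)%:E = (F b - F a)%:E)%E.
Proof.
move=> ab Fd fc.
have mf : measurable_fun setT f by exact: continuous_measurable_fun.
have cF : continuous F.
  by move=> x; apply/differentiable_continuous/derivable1_diffP/ex_derive.
rewrite -(integral_itv_bndoo true false); last first.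
  by apply/measurable_EFinP; exact: measurable_funS mf.
rewrite (continuous_FTC2 (F := F)) //.
- exact: continuous_subspaceT.
- split=> [x _||]; first exact: ex_derive.
  + exact/cvg_at_right_filter/cF.
  + exact/cvg_at_left_filter/cF.
- by move=> x _; rewrite derive1E; exact: derive_val.
Qed.

Lemma integral_oy_derive (F f : R -> R) (a l : R) :
  (forall x : R, is_derive x 1 F (f x)) -> continuous f ->
  (forall x, a <= x -> 0 <= f x) -> F x @[x --> +oo] --> l ->
  (\int[mu]_(x in `]a, +oo[) (f x)%:E = (l - F a)%:E)%E.
Proof.
move=> Fd fc f0 Fl.
have mf : measurable_fun setT f by exact: continuous_measurable_fun.
have cF : continuous F.
  by move=> x; apply/differentiable_continuous/derivable1_diffP/ex_derive.
rewrite integral_itv_obnd_cbnd; last first.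
  by apply/measurable_EFinP; exact: measurable_funS mf.
rewrite (ge0_continuous_FTC2y (F := F) (l := l)) //.
- exact: continuous_subspaceT.
- exact/cvg_at_right_filter/cF.
- by move=> x _; rewrite derive1E; exact: derive_val.
Qed.

Lemma derive_continuous (f : R -> R) : (forall x : R, derivable f x 1) -> continuous f.
Proof. by move=> fd x; apply/differentiable_continuous/derivable1_diffP. Qed.

Lemma integral_sin2 : (\int[mu]_(x in `]0%R, pi[) (sin x ^+ 2)%:E = (pi / 2)%:E)%E.
Proof.
have Fd (x : R) : is_derive x 1 (fun x : R => 2^-1 * (x - sin x * cos x)) (sin x ^+ 2).
  have d := is_deriveZ (2^-1 : R) (is_deriveB (is_derive_id x 1)
    (is_deriveM (is_derive_sin x) (is_derive_cos x))).
  apply: is_derive_eq d _; rewrite /GRing.scale /=.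
  have := cos2Dsin2 x => /(canRL (addrK _)); rewrite expr2 => c2.
  by rewrite c2; field.
have fc : continuous (fun x : R => sin x ^+ 2).
  by apply: derive_continuous => x; have [] := is_derive_sqr (is_derive_sin x).
rewrite (integral_oo_derive (pi_gt0 R) Fd fc).
by rewrite sinpi sin0 !mul0r !subr0 mulr0 subr0 mulrC.
Qed.

Lemma integral_sin : (\int[mu]_(x in `]0%R, pi[) (sin x)%:E = 2%:E)%E.
Proof.
have Fd (x : R) : is_derive x 1 (fun x : R => - cos x) (sin x).
  by have d := is_deriveN (is_derive_cos x); apply: is_derive_eq d _; rewrite opprK.
rewrite (integral_oo_derive (pi_gt0 R) Fd (@continuous_sin R)).
by rewrite cospi cos0 !opprK.
Qed.

Lemma profile_dh_ge0 (y : R) : 0 <= y -> 0 <= profile_dh y.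
Proof.
rewrite le_eqVlt => /predU1P[<-|y0]; first by rewrite /profile_dh sinh0 mulr0 !mul0r.
have s0 := ltW (sinh_gt0 y0); have c0 : 0 <= cosh y := le_trans ler01 (cosh_ge1 y).
by rewrite /profile_dh divr_ge0 ?sqr_ge0 // mulr_ge0 // mulr_ge0.
Qed.

(** This form exhibits the limit 1/2. *)
Lemma profile_hE (y : R) : profile_h y = 2^-1 - 3 / 2 * (profile_den y)^-1.
Proof.
rewrite /profile_h; have := profile_den_neq0 y.
by rewrite /profile_den => ?; field.
Qed.

Lemma profile_h_cvg : (@profile_h R) y @[y --> +oo] --> (2^-1 : R).
Proof.
apply/cvgrPdist_le => eps eps0; near=> y.
have y1 : 1 <= y by near: y; apply: nbhs_pinfty_ge; rewrite num_real.
have ye : eps^-1 <= y by near: y; apply: nbhs_pinfty_ge; rewrite num_real.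
have y0 : 0 < y by exact: lt_le_trans y1.
have D0 := profile_den_gt0 y.
have Dy : 2 * y <= profile_den y.
  by rewrite /profile_den; have := sinh_ge y0; nra.
rewrite profile_hE opprB addrC subrK ger0_norm; last first.
  by rewrite mulr_ge0 ?invr_ge0 // ltW.
rewrite ler_pdivrMr //.
have : 1 <= eps * y by rewrite -ler_pdivrMl // mulr1.
have := ler_wpM2l (ltW eps0) Dy.
by lra.
Unshelve. all: by end_near. Qed.

(** The derivative of 3 h - 4 h^3, the Chern-Simons function up to sign and a
    constant. *)
Definition cs_density (y : R) : R := 12 * (profile_dh y * (4^-1 - profile_h y ^+ 2)).

Lemma cs_density_ge0 (y : R) : 0 <= y -> 0 <= cs_density y.
Proof.
move=> y0; have dh0 := profile_dh_ge0 y0.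
have h0 : 0 <= profile_h y.
  by rewrite /profile_h divr_ge0 ?sqr_ge0 // ltW ?profile_den_gt0.
have h1 : profile_h y <= 2^-1.
  by rewrite profile_hE gerBl mulr_ge0 ?invr_ge0 // ltW ?profile_den_gt0.
have -> : cs_density y =
    12 * (profile_dh y * ((2^-1 - profile_h y) * (2^-1 + profile_h y))).
  by rewrite /cs_density; field.
by do 3 apply: mulr_ge0 => //; lra.
Qed.

Lemma derivable_profile_dh (y : R) : derivable (@profile_dh R) y 1.
Proof.
have d := is_deriveM (is_deriveZ (6 : R) (is_derive_sinh y)) (is_derive_cosh y).
have den2 : profile_den y ^+ 2 != 0 by rewrite expf_neq0 ?profile_den_neq0.
by have [] := is_derive_div (b := fun t => profile_den t ^+ 2) den2 d
  (is_derive_sqr (is_derive_profile_den y)).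
Qed.

Lemma cs_density_continuous : continuous cs_density.
Proof.
apply: derive_continuous => y.
have dh := derivableP (@derivable_profile_dh y).
have d2 := is_deriveB (is_derive_cst (4^-1 : R) y 1)
  (is_derive_sqr (is_derive_profile_h y)).
by have [] := is_deriveZ (12 : R) (is_deriveM dh d2).
Qed.

(** The increment of 3 h - 4 h^3 when h goes from 0 to 1/2. *)
Lemma integral_cs_density :
  (\int[mu]_(y in `]0%R, +oo[) (cs_density y)%:E = 1%:E)%E.
Proof.
have Fd (y : R) : is_derive y 1
    (fun y => 3 * profile_h y - 4 * (profile_h y * profile_h y ^+ 2)) (cs_density y).
  have h := is_derive_profile_h y.
  have d := is_deriveB (is_deriveZ (3 : R) h)
    (is_deriveZ (4 : R) (is_deriveM h (is_derive_sqr h))).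
  apply: is_derive_eq d _; rewrite /GRing.scale /= /GRing.scale /= /cs_density.
  by field.
rewrite (integral_oy_derive (l := 3 * 2^-1 - 4 * (2^-1 * 2^-1 ^+ 2)) Fd
  cs_density_continuous cs_density_ge0).
  congr (_%:E); rewrite /profile_h sinh0 expr0n /= !mul0r !mulr0 !subr0.
  by field.
have hc := profile_h_cvg.
apply: cvgB; first by apply: cvgM hc; exact: cvg_cst.
by apply: cvgM; [exact: cvg_cst | apply: (cvgM hc); exact: (cvgM hc hc)].
Qed.

End Integration.

(** * The instanton number *)

Section Instanton.
Variable R : realType.
Local Notation mu := (@lebesgue_measure R).

(** The volume density of the unit sphere; the trailing factor 1 is the trivial
    dependence on the longitude. *)
Definition angular (z : R * R * R) : R := sin z.1.1 ^+ 2 * sin z.1.2 * 1.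
Definition angular_dom : set (R * R * R) :=
  `]0, pi[ `*` `]0, pi[ `*` `]0, (2 * pi)[.

Lemma sin_itv_ge0 (x : R) : `]0, pi[%classic x -> 0 <= sin x.
Proof. by rewrite /= in_itv /= => x_itv; apply: ltW; exact: sin_gt0_pi. Qed.

Lemma measurable_sin : measurable_fun setT (@sin R).
Proof. by apply: continuous_measurable_fun; exact: continuous_sin. Qed.

Lemma measurable_sin2sin :
  measurable_fun setT (fun z : R * R => sin z.1 ^+ 2 * sin z.2).
Proof.
have ms := measurable_sin.
apply: measurable_funM; last exact: measurableT_comp ms measurable_snd.
apply: measurable_funX; exact: measurableT_comp ms measurable_fst.
Qed.

Lemma measurable_angular : measurable_fun setT angular.
Proof.
apply: measurable_funM; last exact: measurable_cst.
exact: measurableT_comp measurable_sin2sin measurable_fst.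
Qed.

Lemma measurable_angular_dom : measurable angular_dom.
Proof. by do 2![apply: measurableX => //]. Qed.

(** The volume 2 pi^2 of the unit 3-sphere. *)
Lemma integral_angular :
  (\int[prod_measure (prod_measure mu mu) mu]_(z in angular_dom) (angular z)%:E
   = (2 * pi ^+ 2)%:E)%E.
Proof.
have ms := measurable_sin.
rewrite /angular_dom /angular.
rewrite (@integral_prod_tensor _ _ _ _ _ (prod_measure mu mu) mu _ _
  (fun z : R * R => sin z.1 ^+ 2 * sin z.2) (fun=> 1)) //.
- rewrite (@integral_prod_tensor _ _ _ _ _ mu mu _ _
    (fun x : R => sin x ^+ 2) sin) //.
  + rewrite integral_sin2 integral_sin integral_cst //= lebesgue_measure_itv /=.
    rewrite lte_fin mulr_gt0 ?pi_gt0 // mul1e oppr0 adde0 -!EFinM.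
    by congr (_%:E); field.
  + exact/measurable_funTS/measurable_funX.
  + exact/measurable_funTS.
  + by move=> x _; exact: sqr_ge0.
  + exact: sin_itv_ge0.
- exact: measurableX.
- by apply: measurable_funTS; exact: measurable_sin2sin.
- by move=> z [/= _ z2]; rewrite mulr_ge0 ?sqr_ge0 //; exact: sin_itv_ge0.
Qed.

Definition instanton_weight (z : R * R * R * R) : R := angular z.1 * cs_density z.2.

Lemma angular_ge0 z : angular_dom z -> 0 <= angular z.
Proof.
move=> [[_ z2] _]; rewrite /angular mulr1 mulr_ge0 ?sqr_ge0 //.
exact: sin_itv_ge0.
Qed.

Lemma cs_dom_ge0 (y : R) : `]0, +oo[%classic y -> 0 <= cs_density y.
Proof. by rewrite /= in_itv /= andbT => y0; rewrite cs_density_ge0 // ltW. Qed.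

Lemma measurable_cs : measurable_fun setT (@cs_density R).
Proof. by apply: continuous_measurable_fun; exact: cs_density_continuous. Qed.

Lemma integral_instanton_weight :
  (\int[@lebesgue4 R]_(z in @param_dom R) (instanton_weight z)%:E
   = (2 * pi ^+ 2)%:E)%E.
Proof.
apply: etrans (integral_prod_tensor (prod_measure (prod_measure mu mu) mu) mu
  (A := angular_dom) (B := `]0, +oo[) (a := angular) (b := @cs_density R)
  measurable_angular_dom (measurable_itv _) (measurable_funTS measurable_angular)
  (measurable_funTS measurable_cs) angular_ge0 cs_dom_ge0) _.
by rewrite integral_angular integral_cs_density mule1.
Qed.

Local Notation TR := (measurableTypeR R).

Lemma measurable_param_dom :
  measurable (@param_dom R : set (TR * TR * TR * TR)).
Proof. by do 3![apply: measurableX => //]. Qed.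

Lemma integrable_instanton_weight :
  (@lebesgue4 R).-integrable (@param_dom R) (EFin \o instanton_weight).
Proof.
apply/integrableP; split.
  apply/measurable_EFinP/measurable_funTS; apply: measurable_funM.
    exact: measurableT_comp measurable_angular measurable_fst.
  exact: measurableT_comp measurable_cs measurable_snd.
rewrite (_ : \int[_]_(_ in _) _ =
   \int[@lebesgue4 R]_(z in @param_dom R) (instanton_weight z)%:E)%E.
  by rewrite integral_instanton_weight ltry.
apply: eq_integral => z /set_mem [za zy] /=; rewrite ger0_norm //.
by rewrite mulr_ge0 ?angular_ge0 ?cs_dom_ge0.
Qed.

(** By e^2 = 1, f' (f^2 - f) is e h' (h^2 - 1/4). *)
Lemma instanton_integrandE e z : e ^+ 2 = 1 -> @param_dom R z ->
  instanton_integrand (radial (@profile_f R e)) z = - e * instanton_weight z.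
Proof.
case: z => [[[c t] s] y] e2 [[[cI tI] sI] yI].
rewrite /= !in_itv /= in cI tI yI; rewrite andbT in yI.
rewrite /instanton_integrand param_densityE //.
rewrite (trF2_radial (param_cyl c t s yI) (is_derive_profile_f e y)).
rewrite /instanton_weight /angular /cs_density /=.
have -> : profile_f e y ^+ 2 - profile_f e y = e ^+ 2 * profile_h y ^+ 2 - 4^-1.
  by rewrite /profile_f; field.
by rewrite e2; ring.
Qed.

Lemma has_instanton_number_radial e : e ^+ 2 = 1 ->
  has_instanton_number (radial (@profile_f R e)) (- e / 2).
Proof.
move=> e2; have intW := integrable_instanton_weight.
split.
  have iW := integrableZl measurable_param_dom (- e) intW.
  refine (eq_integrable measurable_param_dom _ _ _ iW).
  by move=> z /set_mem zD /=; rewrite instanton_integrandE.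
have -> : Rintegral (@lebesgue4 R) (@param_dom R)
    (instanton_integrand (radial (profile_f e))) =
  Rintegral (@lebesgue4 R) (@param_dom R) (fun z => - e * instanton_weight z).
  by apply: eq_Rintegral => z /set_mem zD; exact: instanton_integrandE.
rewrite RintegralZl; [|exact: measurable_param_dom|exact: intW].
rewrite /Rintegral integral_instanton_weight /=.
have p0 : pi != 0 :> R by rewrite gt_eqF ?pi_gt0.
(* [pi] is defined as a double, which [field] would unfold. *)
by move: (@pi R) p0 => p p0; field.
Qed.

End Instanton.

(** * The two solutions *)

Theorem theorem1p4 (R : realType) :
  (exists A phi : form1 R,
     [/\ su2_form1 A, su2_form1 phi, kapustin_witten A phi, nahm_pole A phi
       & has_instanton_number A 2^-1]) /\
  (exists A phi : form1 R,
     [/\ su2_form1 A, su2_form1 phi, kapustin_witten A phi, nahm_pole A phi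
       & has_instanton_number A (- 2^-1)]).
Proof.
have sol (e : R) : e ^+ 2 = 1 -> exists A phi : form1 R,
     [/\ su2_form1 A, su2_form1 phi, kapustin_witten A phi, nahm_pole A phi
       & has_instanton_number A (- e / 2)].
  move=> e2; exists (radial (profile_f e)), (radial (@profile_g R)); split.
  - exact/su2_form1_radial/elementary_profile_f.
  - exact/su2_form1_radial/elementary_profile_g.
  - exact: (kapustin_witten_radial (fun y _ => is_derive_profile_f e y)
      (fun y y0 => is_derive_profile_g e2 y0) (fun y y0 => profile_f_ode e y0)
      (fun _ _ => erefl)).
  - exact: nahm_pole_profiles.
  - exact: has_instanton_number_radial.
split.
- have := sol (-1); rewrite sqrrN expr1n opprK mul1r; exact.
- have := sol 1; rewrite expr1n mulN1r; exact.
Qed.
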